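(* Fix an integer $k\ge3$. Let $\Omega=\mathbb{Z}/N\mathbb{Z}$ or $\Omega=[N]$. Let $p=p_N\in(0,1)$ and $\delta=\delta_N>0$ be such that $p\to0$ and $\delta^{-3}p^{k-2}(\log(1/p))^2\to\infty$. Then, as $N\to\infty$, $$\phi_p^{(k,\Omega)}(\delta)=\begin{cases}\left(\dfrac{1}{2k^2}+o(1)\right)\delta^2Np&\text{if }\Omega=\mathbb{Z}/N\mathbb{Z},\\[2mm]\left(\dfrac{1}{2\gamma_k}+o(1)\right)\delta^2Np&\text{if }\Omega=[N],\end{cases}$$ where $$\gamma_k=\frac43\left(k+\sum_{0\le i<j<k}\frac{(k-1)^2-i^2-(k-1-j)^2}{(k-1-i)\,j}\right).$$
   Context: $[N]=\{1,\dots,N\}$. The ambient group is $\mathbb{Z}$ if $\Omega=[N]$ and $\mathbb{Z}/N\mathbb{Z}$ if $\Omega=\mathbb{Z}/N\mathbb{Z}$. For $f:\Omega\to\mathbb{R}$, $T_k(f)=\sum_{a,b} f(a)f(a+b)\cdots f(a+(k-1)b)$, the sum over pairs $(a,b)$ of elements of the ambient group with $\{a,a+b,\dots,a+(k-1)b\}\subset\Omega$ ($b=0$ and negative differences allowed); $T_k(\Omega)$ is the number of such pairs. $I_p(x)=x\log\frac{x}{p}+(1-x)\log\frac{1-x}{1-p}$ for $x\in[0,1]$ (with $0\log 0=0$), and $$\phi_p^{(k,\Omega)}(\delta)=\inf_{f:\Omega\to[0,1]}\Big\{\sum_{a\in\Omega}I_p(f(a)) : T_k(f)\ge(1+\delta)p^kT_k(\Omega)\Big\}.$$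 *)

(* Defs.v *)
From mathcomp Require Import all_boot all_order all_algebra.
From mathcomp Require Import finmap.
From mathcomp Require Import all_classical all_reals all_analysis.

Set Implicit Arguments.
Unset Strict Implicit.
Unset Printing Implicit Defensive.

Import Order.TTheory GRing.Theory Num.Theory.
Import numFieldNormedType.Exports.

Local Open Scope classical_set_scope.
Local Open Scope ring_scope.

Section Progressions.
Context {G : zmodType} {R : realType}.

Definition kAP (k : nat) (Omega : set G) : set (G * G) :=
  [set ab | forall i : nat, (i < k)%N -> Omega (ab.1 + ab.2 *+ i)].

(* For finite Omega and k >= 2 the set [kAP k Omega] is finite, so the
   finitely supported sum and [fset_set] below do not take their default
   values.  Functions on Omega are represented by functions on G, of which
   only the values on Omega are ever used. *)
Definition Tk (k : nat) (Omega : set G) (f : G -> R) : R :=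
  \sum_(ab \in kAP k Omega) \prod_(i < k) f (ab.1 + ab.2 *+ i).

Definition nAP (k : nat) (Omega : set G) : nat :=
  #|` fset_set (kAP k Omega)|.

(* 0 log 0 = 0: [ln] is total, so the vanishing factor gives 0. *)
Definition Irel (p x : R) : R :=
  x * ln (x / p) + (1 - x) * ln ((1 - x) / (1 - p)).

(* Extended-real valued: the infimum of the empty set is +oo. *)
Definition phi (k : nat) (Omega : set G) (p delta : R) : \bar R :=
  ereal_inf [set (\sum_(a \in Omega) Irel p (f a))%:E | f in
    [set f : G -> R | (forall a, Omega a -> 0 <= f a <= 1) /\
       (1 + delta) * p ^+ k * (nAP k Omega)%:R <= Tk k Omega f]].

End Progressions.

(* ['Z_N] is Z/NZ only for N >= 2; for N <= 1 it is Z/2Z. *)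
Definition cyclic (N : nat) : set 'Z_N := setT.
Arguments cyclic : clear implicits.

Definition seg (N : nat) : set int := [set x : int | 1 <= x <= N%:Z].

Definition gammak {R : realType} (k : nat) : R :=
  4 / 3 * (k%:R + \sum_(j < k) \sum_(i < k | (i < j)%N)
    ((k%:R - 1) ^+ 2 - i%:R ^+ 2 - (k%:R - 1 - j%:R) ^+ 2)
      / ((k%:R - 1 - i%:R) * j%:R)).

(* u N = (c + o(1)) * v N as N -> oo. *)
Definition asymp {R : realType} (u : nat -> \bar R) (c : R) (v : nat -> R) :
    Prop :=
  exists2 e : nat -> R, e N @[N --> \oo] --> (0 : R) &
    \forall N \near \oo, u N = ((c + e N) * v N)%:E.

(* Main.v *)
(** Write f = p (1 + u); replacing f by max(f, p) we may take u >= 0.  To first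
    order T_k(f) - p^k T_k(Omega) is p^k times the linear form sum_x w(x) u(x),
    where w(x) counts the progressions through x with their position, and
    I_p(f(x)) is p u(x)^2 / 2, so by Cauchy-Schwarz the infimum is
    p (delta T)^2 / (2 sum_x w(x)^2) with T = T_k(Omega), attained at u
    proportional to w; since w >= 0 the higher order terms only help there.

    For the lower bound the nonlinear terms must be o(delta N^2).  A product of
    s of the u's is at most (a b)^(s/2) with a, b its two largest factors, so
    with psi(u) = max(u, u^(k/2)) the nonlinear part is O((sum_x psi(u(x)))^2).
    A feasible f of cost O(delta^2 N p) satisfies
    sum_x psi(u(x)) = o(delta^(1/2) N): where u <= 1 this is Cauchy-Schwarz,
    and where u >= 1 the ratio of u^(k/2) to the cost is largest at u = 1/p,
    which is exactly where the hypothesis on delta enters.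

    It remains to find lim N (sum_x w(x)^2) / T^2.  In Z/NZ w is the constant
    k N.  In [N] both sums are monotone in N, so N may be taken to be a multiple
    of k - 1, and then they are Riemann sums of piecewise quadratic functions
    with integer break points. *)

Require Import Defs.
From mathcomp Require Import all_boot all_order all_algebra.
From mathcomp Require Import finmap.
From mathcomp Require Import all_classical all_reals all_analysis.
From mathcomp Require Import zify ring lra.
Import Order.TTheory GRing.Theory Num.Theory.
Import numFieldNormedType.Exports.
Local Open Scope classical_set_scope.
Local Open Scope ring_scope.

(** * Elementary bounds on the relative entropy *)

(* I_p(p (1 + u)) / p is at least this, and equal to it up to O(p u^2). *)
Definition poisson_rate {R : realType} (u : R) : R := (1 + u) * ln (1 + u) - u.

Lemma ge1_derive_ge0 {R : realType} (f f' : R -> R) (y : R) :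
  (forall x : R, 1 <= x -> is_derive x (1 : R) f (f' x)) ->
  (forall x : R, 1 <= x -> 0 <= f' x) -> 1 <= y -> f 1 <= f y.
Proof.
move=> df f'0 y1.
apply: (@ger0_derive1_le_cc R f 1 y) => //; rewrite ?in_itv /= ?lexx ?y1 //.
- move=> x; rewrite in_itv /= => /andP[x1 _].
  by have [] := df x (ltW x1).
- move=> x; rewrite in_itv /= => /andP[x1 _].
  have [_] := df x (ltW x1); rewrite derive1E => ->; exact: f'0 (ltW x1).
apply: derivable_within_continuous => x; rewrite in_itv /= => /andP[x1 _].
by have [] := df x x1.
Qed.

(** At x = 1 + u the difference of the two sides is [ln x + 4 / (x + 1) - 2], which vanishes at 1
    and has derivative [(x - 1)^2 / (x (x + 1)^2)]. *)
Lemma ln_ge_pade {R : realType} (u : R) : 0 <= u -> 2 * u / (2 + u) <= ln (1 + u).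
Proof.
move=> u0; have y1 : 1 <= 1 + u by lra.
pose f (x : R) : R := ln x + 4 * (x + 1)^-1.
pose f' (x : R) : R := x^-1 - 4 * (x + 1) ^- 2.
have : f 1 <= f (1 + u).
  apply: (@ge1_derive_ge0 _ f f') => // x x1.
    have x0 : 0 < x by lra.
    have xn : x + 1 != 0 by apply/lt0r_neq0; lra.
    have H1 := is_derive1_ln x0.
    have H2 : is_derive x (1 : R) (fun z : R => z + 1) 1.
      have -> : (fun z : R => z + 1) = id \+ cst 1 by [].
      by apply: is_derive_eq; rewrite addr0.
    have H3 := @is_deriveV R (fun z => z + 1) x 1 1 xn H2.
    have H : is_derive x (1 : R) (@ln R \+ (4 \*: (fun z : R => (z + 1)^-1))) (f' x).
      apply: is_derive_eq; rewrite /f' /GRing.scale /=; ring.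
    exact: H.
  have -> : f' x = (x - 1) ^+ 2 / (x * (x + 1) ^+ 2) by rewrite /f'; field; lra.
  by rewrite divr_ge0 ?mulr_ge0 ?sqr_ge0 //; lra.
rewrite /f ln1 add0r; have -> : 4 * (1 + 1)^-1 = 2 :> R by field.
move=> H.
have -> : 2 * u / (2 + u) = 2 - 4 * (1 + u + 1)^-1 by field; lra.
lra.
Qed.

(** Multiply [ln x <= (x - 1/x) / 2] by x = 1 + u; the derivative of the difference is
    [(1/x - 1)^2 / 2]. *)
Lemma poisson_rate_le {R : realType} (u : R) : 0 <= u -> poisson_rate u <= u ^+ 2 / 2.
Proof.
move=> u0; have y1 : 1 <= 1 + u by lra.
pose f (x : R) : R := x / 2 - x^-1 / 2 - ln x.
pose f' (x : R) : R := 2^-1 + x ^- 2 / 2 - x^-1.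
have : f 1 <= f (1 + u).
  apply: (@ge1_derive_ge0 _ f f') => // x x1.
    have x0 : 0 < x by lra.
    have xn : x != 0 by apply/lt0r_neq0; lra.
    have H1 := is_derive1_ln x0.
    have H3 := @is_deriveV R id x 1 1 xn (is_derive_id _ _).
    have H : is_derive x (1 : R) ((2^-1 \*: id) - (2^-1 \*: (fun z : R => z^-1)) - @ln R) (f' x).
      apply: is_derive_eq; rewrite /f' /GRing.scale /=; ring.
    apply: is_derive_eq; rewrite /f' /GRing.scale /=; field; exact: xn.
  have -> : f' x = (x^-1 - 1) ^+ 2 / 2 by rewrite /f' -exprVn; field; lra.
  by rewrite divr_ge0 ?sqr_ge0.
rewrite /f ln1 invr1 => H; rewrite /poisson_rate.
have : ln (1 + u) <= (1 + u) / 2 - (1 + u)^-1 / 2 by lra.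
rewrite -(ler_pM2l (x := 1 + u)); last lra.
have -> : (1 + u) * ((1 + u) / 2 - (1 + u)^-1 / 2) = u + u ^+ 2 / 2 by field; lra.
lra.
Qed.

(** This bound has the sharp constant 1/2 at u = 0, and the denominator [2 + u] is the weight used
    later in Cauchy-Schwarz. *)
Lemma poisson_rate_ge {R : realType} (u : R) : 0 <= u -> u ^+ 2 / (2 + u) <= poisson_rate u.
Proof.
move=> u0; rewrite /poisson_rate lerBrDr.
apply: le_trans (ler_wpM2l _ (ln_ge_pade u u0)); last lra.
by rewrite le_eqVlt; apply/orP; left; apply/eqP; field; lra.
Qed.

Lemma poisson_rate_ge0 {R : realType} (u : R) : 0 <= u -> 0 <= poisson_rate u.
Proof.
move=> u0; apply: le_trans (poisson_rate_ge u u0).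
by rewrite divr_ge0 ?sqr_ge0 //; lra.
Qed.

Lemma ln_le_sub1 {R : realType} (x : R) : 0 < x -> ln x <= x - 1.
Proof.
move=> x0; have {1}-> : x = 1 + (x - 1) by ring.
by apply: le_ln1Dx; lra.
Qed.

(** This is [ln y <= y - 1] at y = b / a. Applied to (x, p) and (1 - x, 1 - p), the two lower bounds
    cancel, whence [Irel >= 0]. *)
Lemma xlnx_ge {R : realType} (a b : R) : 0 <= a -> 0 < b -> a - b <= a * ln (a / b).
Proof.
move=> a0 b0; have [->|an] := eqVneq a 0; first by rewrite mul0r; lra.
have ap : 0 < a by rewrite lt0r an.
have ba : 0 < b / a by rewrite divr_gt0.
have H := ln_le_sub1 _ ba.
have -> : a / b = (b / a)^-1 by rewrite invf_div.
rewrite lnV ?posrE //.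
have : a * ln (b / a) <= a * (b / a - 1) by rewrite ler_wpM2l.
have -> : a * (b / a - 1) = b - a by field.
lra.
Qed.

Lemma Irel_ge0 {R : realType} (p x : R) : 0 < p < 1 -> 0 <= x <= 1 -> 0 <= Irel p x.
Proof.
move=> /andP[p0 p1] /andP[x0 x1]; rewrite /Irel.
have := xlnx_ge x p x0 p0; have := xlnx_ge (1 - x) (1 - p); lra.
Qed.

Lemma Irel_self {R : realType} (p : R) : 0 < p < 1 -> Irel p p = 0.
Proof.
move=> /andP[p0 p1]; rewrite /Irel !divff ?ln1 ?mulr0 ?addr0 //; lra.
Qed.

(** Raising a value below p to p brings its cost to 0; this is what permits u >= 0. *)
Lemma Irel_max {R : realType} (p x : R) : 0 < p < 1 -> 0 <= x <= 1 ->
  Irel p (Num.max x p) <= Irel p x.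
Proof.
by move=> hp hx; case: (leP x p) => // _; rewrite Irel_self // Irel_ge0.
Qed.

Lemma Irel_lower {R : realType} (p u : R) : 0 < p < 1 -> 0 <= u ->
  p * (1 + u) <= 1 -> p * poisson_rate u <= Irel p (p * (1 + u)).
Proof.
move=> /andP[p0 p1] u0 h; rewrite /Irel /poisson_rate.
have -> : p * (1 + u) / p = 1 + u by field; lra.
have := xlnx_ge (1 - p * (1 + u)) (1 - p); lra.
Qed.

(** The first logarithm is bounded by [poisson_rate_le], the second by its tangent. The linear terms
    in u cancel, and the tangent leaves the error [p u^2 * p / (1 - p)]. *)
Lemma Irel_upper {R : realType} (p u : R) : 0 < p < 1 -> 0 <= u ->
  p * (1 + u) <= 1 ->
  Irel p (p * (1 + u)) <= p * (u ^+ 2 / 2) * (1 + 2 * p / (1 - p)).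
Proof.
move=> /andP[p0 p1] u0 h; rewrite /Irel.
have -> : p * (1 + u) / p = 1 + u by field; lra.
have H1 := poisson_rate_le u u0; rewrite /poisson_rate in H1.
set y := (1 - p * (1 + u)).
have y0 : 0 <= y by rewrite /y; lra.
have H2 : y * ln (y / (1 - p)) <= y * (y / (1 - p) - 1).
  have [->|yn] := eqVneq y 0; first by rewrite !mul0r.
  apply: ler_wpM2l => //; have yp : 0 < y by rewrite lt0r yn.
  have : 0 < y / (1 - p) by rewrite divr_gt0 //; lra.
  exact: ln_le_sub1.
have E : y * (y / (1 - p) - 1) = - p * u + p * u ^+ 2 * (p / (1 - p)).
  by rewrite /y; field; lra.
have : p * ((1 + u) * ln (1 + u) - u) <= p * (u ^+ 2 / 2) by rewrite ler_wpM2l // ltW.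
lra.
Qed.

(** * The gauge of the nonlinear terms *)

(* At scale u = x / p - 1, the size of a g^(k/2) in the expansion of T_k(p + g). *)
Definition psi {R : realType} (k : nat) (u : R) : R := Num.max u (Num.sqrt u ^+ k).

Lemma psi_ge0 {R : realType} (k : nat) (u : R) : 0 <= u -> 0 <= psi k u.
Proof. by move=> u0; rewrite le_max u0. Qed.

Lemma le_psi {R : realType} (k : nat) (u : R) : u <= psi k u.
Proof. by rewrite le_max lexx. Qed.

Lemma psi_small {R : realType} (k : nat) (u : R) : (2 <= k)%N -> 0 <= u <= 1 -> psi k u = u.
Proof.
move=> k2 /andP[u0 u1]; apply/max_idPl.
rewrite -{2}(sqr_sqrtr u0); have s1 : Num.sqrt u <= 1 by rewrite -[leRHS]sqrtr1 ler_wsqrtr.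
by apply: ler_wiXn2l => //; exact: sqrtr_ge0.
Qed.

(** With r = sqrt(u p) <= 1, the left side is [u r^(k-2) ln (1/p)]. Here [r^(k-2) <= r] as k >= 3,
    and 1/p = u / r^2 gives [r ln (1/p) = r ln u + 2 r ln (1/r) <= ln (1 + u) + 2]. *)
Lemma psi_large {R : realType} (k : nat) (p u : R) : (3 <= k)%N -> 0 < p < 1 ->
  1 <= u -> u * p <= 1 ->
  psi k u * (Num.sqrt p ^+ (k - 2) * ln (1 / p)) <= 10 * poisson_rate u.
Proof.
move=> k3 /andP[p0 p1] u1 up1.
have u0 : 0 < u by lra.
have -> : psi k u = u * Num.sqrt u ^+ (k - 2).
  rewrite -{2}(sqr_sqrtr (ltW u0)) -exprD subnKC; last by apply: leq_trans k3.
  apply/max_idPr; rewrite -{1}(sqr_sqrtr (ltW u0)); apply: ler_weXn2l; last exact: leq_trans k3.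
  by rewrite -sqrtr1 ler_wsqrtr.
set r := Num.sqrt (u * p).
have upp : 0 < u * p by rewrite mulr_gt0.
have r0 : 0 < r by rewrite sqrtr_gt0.
have r1 : r <= 1 by rewrite -sqrtr1 ler_wsqrtr.
have L0 : 0 <= ln (1 / p) by apply: ln_ge0; rewrite div1r invf_ge1 // ltW.
have -> : u * Num.sqrt u ^+ (k - 2) * (Num.sqrt p ^+ (k - 2) * ln (1 / p)) =
    u * (r ^+ (k - 2) * ln (1 / p)).
  by rewrite /r sqrtrM ?exprMn; [ring|exact: ltW].
have lnu0 : 0 <= ln u by exact: ln_ge0.
have lnr : r * ln (1 / p) <= ln (1 + u) + 2.
  have -> : ln (1 / p) = ln u + 2 * ln (r^-1).
    have -> : 1 / p = u * (r ^+ 2)^-1 by rewrite /r sqr_sqrtr ?ltW //; field; rewrite !lt0r_neq0.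
    rewrite lnM ?posrE ?invr_gt0 ?exprn_gt0 // -exprVn lnXn ?invr_gt0 //; ring.
  have : ln u <= ln (1 + u) by rewrite ler_ln ?posrE //; lra.
  have h : r * ln u <= ln u by rewrite ler_piMl.
  have : r * ln (r^-1) <= 1.
    have : ln (r^-1) <= r^-1 by apply: ltW; apply: ln_sublinear; rewrite invr_gt0.
    move/(ler_wpM2l (ltW r0)); rewrite mulfV //; lra.
  rewrite mulrDr mulrCA; lra.
have rk : r ^+ (k - 2) <= r.
  rewrite -{2}[r]expr1; apply: ler_wiXn2l => //; first exact: ltW.
  by rewrite subn_gt0.
(* The constant 10 is 4 + 2 * 3: [u ln (1 + u)] costs 4 rates by [H2], and 2 u costs 6 by [H1]. *)
have H1 : u <= 3 * poisson_rate u.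
  have := poisson_rate_ge u (ltW u0).
  have : u / 3 <= u ^+ 2 / (2 + u).
    rewrite ler_pdivlMr; [nra|lra].
  lra.
have H2 : u * ln (1 + u) <= 4 * poisson_rate u.
  have : 0 <= ln (1 + u) by apply: ln_ge0; lra.
  have : poisson_rate u = (1 + u) * ln (1 + u) - u by [].
  lra.
have : r ^+ (k - 2) * ln (1 / p) <= ln (1 + u) + 2.
  by apply: le_trans lnr; apply: ler_wpM2r.
move/(ler_wpM2l (ltW u0)); lra.
Qed.

(** * Sum inequalities and expansion of products *)

Lemma ler_sum_subset {R : realType} {T : eqType} (s1 s2 : seq T) (F : T -> R) :
  uniq s1 -> {subset s1 <= s2} -> (forall x, x \in s2 -> 0 <= F x) ->
  \sum_(x <- s1) F x <= \sum_(x <- s2) F x.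
Proof.
elim: s1 s2 => [|x s1 IH] s2 /=.
  by move=> _ _ F0; rewrite big_nil big_seq; apply: sumr_ge0.
move=> /andP[xs1 us1] sub F0.
have xs2 : x \in s2 by apply: sub; rewrite mem_head.
rewrite big_cons (big_rem x xs2) /= lerD2l; apply: IH => // y.
  move=> ys1; have : y \in s2 by apply: sub; rewrite inE ys1 orbT.
  rewrite (perm_mem (perm_to_rem xs2)) inE => /predU1P[yx|//].
  by move: xs1; rewrite -yx ys1.
by move=> /mem_rem; exact: F0.
Qed.

Lemma sum_pred1_seq {R : realType} {T : eqType} (s : seq T) (a : T) (F : T -> R) :
  uniq s -> a \in s -> \sum_(x <- s) (a == x)%:R * F x = F a.
Proof.
move=> us as_; rewrite (bigD1_seq a) //= eqxx mul1r big1 ?addr0 // => x.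
by rewrite eq_sym => /negbTE ->; rewrite mul0r.
Qed.

(** Cauchy-Schwarz without square roots, by induction on the list. *)
Lemma sqr_sum_le {R : realType} {T : Type} (s : seq T) (f g h : T -> R) :
  (forall x, 0 <= g x) -> (forall x, 0 <= h x) -> (forall x, f x ^+ 2 <= g x * h x) ->
  (\sum_(x <- s) f x) ^+ 2 <= (\sum_(x <- s) g x) * (\sum_(x <- s) h x).
Proof.
move=> g0 h0 fgh; elim: s => [|x s IH]; first by rewrite !big_nil expr0n mul0r.
rewrite !big_cons.
have G0 : 0 <= \sum_(y <- s) g y by apply: sumr_ge0.
have H0 : 0 <= \sum_(y <- s) h y by apply: sumr_ge0.
set F := \sum_(y <- s) f y in IH *.
set G := \sum_(y <- s) g y in IH G0 *.
set H := \sum_(y <- s) h y in IH H0 *.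
have gx := g0 x; have hx := h0 x; have fx := fgh x.
(* The cross term is handled after squaring: [(2 f F)^2 <= 4 (g h) (G H) <= (G h + g H)^2]. *)
suff : 2 * (f x * F) <= G * h x + g x * H by nra.
have E0 : 0 <= G * h x + g x * H by rewrite addr_ge0 ?mulr_ge0.
apply: le_trans (ler_norm _) _.
rewrite -(@ler_pXn2r _ 2) ?nnegrE // -normrX ger0_norm ?sqr_ge0 //.
have : f x ^+ 2 * F ^+ 2 <= (g x * h x) * (G * H).
  by apply: ler_pM => //; exact: sqr_ge0.
have : 0 <= (G * h x - g x * H) ^+ 2 by exact: sqr_ge0.
nra.
Qed.

(** If b <= 1, the product is at most a b. If b > 1, raise the exponent to k - 1 and move
    [b^(k/2 - 1) <= a^(k/2 - 1)] over to a, which leaves [(a b)^(k/2)]. *)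
Lemma mul_expr_le_psi {R : realType} (k s : nat) (a b : R) :
  (2 <= s <= k)%N -> 0 <= b <= a -> a * b ^+ s.-1 <= psi k a * psi k b.
Proof.
move=> /andP[s2 sk] /andP[b0 ba].
have a0 : 0 <= a by apply: le_trans ba.
have [b1|b1] := leP b 1.
  apply: ler_pM => //; rewrite ?exprn_ge0 ?le_psi //.
  apply: le_trans (le_psi k b); rewrite -[leRHS]expr1; apply: ler_wiXn2l => //.
  by case: s s2 sk => [|[]].
have le_ba : Num.sqrt b <= Num.sqrt a by rewrite ler_wsqrtr.
apply: (@le_trans _ _ (Num.sqrt a ^+ k * Num.sqrt b ^+ k)); last first.
  by apply: ler_pM; rewrite ?exprn_ge0 ?sqrtr_ge0 // le_max lexx orbT.
apply: (@le_trans _ _ (a * b ^+ k.-1)).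
  apply: ler_wpM2l => //; apply: ler_weXn2l; first exact: ltW.
  by rewrite -!subn1 leq_sub2r.
case: k sk => [|[|k]] sk; [by case: s s2 sk|by case: s s2 sk => [|[]]|].
rewrite -{1}(sqr_sqrtr a0) -{1}(sqr_sqrtr b0) -exprM /=.
have -> : (2 * k.+1 = k.+2 + k)%N by lia.
have -> : Num.sqrt a ^+ k.+2 = Num.sqrt a ^+ 2 * Num.sqrt a ^+ k by rewrite -exprD.
have h : Num.sqrt b ^+ k <= Num.sqrt a ^+ k by apply: lerXn2r; rewrite ?nnegrE ?sqrtr_ge0.
have := ler_wpM2l (exprn_ge0 2 (sqrtr_ge0 a)) (ler_wpM2l (exprn_ge0 k.+2 (sqrtr_ge0 b)) h).
move=> H; rewrite [Num.sqrt b ^+ (_ + _)]exprD; apply: (le_trans H).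
by rewrite mulrCA [leRHS]mulrC.
Qed.

(* Only the two largest factors matter: if they are a >= b, then a product of
   s factors is at most a * b ^ (s - 1). *)
Lemma prod_two_largest {R : realType} (k : nat) (u : 'I_k -> R) (i j : 'I_k) (J : {set 'I_k}) :
  (forall l, 0 <= u l) -> (forall l, l != i -> u l <= u j) -> u j <= u i ->
  (2 <= #|J|)%N -> \prod_(l in J) u l <= psi k (u i) * psi k (u j).
Proof.
move=> u0 uj ji J2.
apply: (@le_trans _ _ (u i * u j ^+ #|J|.-1)); last first.
  apply: mul_expr_le_psi; last by rewrite u0.
  by rewrite J2 -[leqRHS]card_ord max_card.
have [iJ|iJ] := boolP (i \in J).
  rewrite (big_setD1 i) //= ; apply: ler_wpM2l => //.
  have -> : (#|J|.-1 = #|J :\ i|)%N by rewrite (cardsD1 i J) iJ.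
  rewrite -prodr_const; apply: ler_prod => l; rewrite in_setD1 => /andP[li _].
  by rewrite u0 uj.
apply: (@le_trans _ _ (u j ^+ #|J|)).
  rewrite -prodr_const; apply: ler_prod => l lJ; rewrite u0 uj //.
  by apply: contraNneq iJ => <-.
case: #|J| J2 => [//|m] _; rewrite exprS.
by apply: ler_wpM2r; rewrite ?exprn_ge0.
Qed.

Lemma exists_two_largest {R : realType} (k : nat) (u : 'I_k -> R) : (2 <= k)%N ->
  exists i j : 'I_k, [/\ j != i, forall l, l != i -> u l <= u j & u j <= u i].
Proof.
move=> k2; pose i0 : 'I_k := Ordinal (ltnW k2 : (0 < k)%N).
pose i1 : 'I_k := Ordinal k2.
have [i _ imax] := @arg_maxP _ _ _ i0 xpredT u isT.
have [j0 j0i] : exists j0 : 'I_k, j0 != i.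
  by case: (eqVneq i i0) => [->|h]; [exists i1|exists i0; rewrite eq_sym].
have [j ji jmax] := @arg_maxP _ _ _ j0 (fun l => l != i) u j0i.
by exists i, j; split=> [//|l li|]; [exact: jmax|exact: imax].
Qed.

(** Expand over subsets of positions: the empty set gives 1, singletons give the linear part, and
    each other subset is at most the psi product at the two largest entries. As these depend on the
    progression, that product is bounded by the sum over all ordered pairs, which can be summed over
    progressions. *)
Lemma prod1D_le {R : realType} (k : nat) (u : 'I_k -> R) : (2 <= k)%N ->
  (forall i, 0 <= u i) ->
  \prod_i (1 + u i) <= 1 + \sum_i u i +
    2 ^+ k * \sum_i \sum_(j | j != i) psi k (u i) * psi k (u j).
Proof.
move=> k2 u0; set Q := \sum_i \sum_(_ | _) _.
have [i [j [ji uj uji]]] := exists_two_largest k u k2.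
have t0 (a b : 'I_k) : 0 <= psi k (u a) * psi k (u b) by rewrite mulr_ge0 ?psi_ge0.
have Qge : psi k (u i) * psi k (u j) <= Q.
  rewrite /Q (bigD1 i) //= (bigD1 j) //= -addrA lerDl addr_ge0 ?sumr_ge0 // => *.
  by apply: sumr_ge0.
under eq_bigr do rewrite addrC.
rewrite bigA_distr.
have bound (J : {set 'I_k}) : \prod_l (if l \in J then u l else 1) <=
    (if J == finset.set0 then 1 else 0) + \sum_l (if J == [set l]%SET then u l else 0) + Q.
  rewrite -big_mkcond /=.
  have Q0 : 0 <= Q by apply: le_trans Qge.
  have S0 : 0 <= \sum_l (if J == [set l]%SET then u l else 0).
    by apply: sumr_ge0 => l _; case: ifP.
  have [J2|] := leqP 2 #|J|.
    apply: le_trans (prod_two_largest k u i j J u0 uj uji J2) _.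
    by apply: le_trans Qge _; rewrite lerDr addr_ge0 //; case: ifP.
  rewrite ltnS leq_eqVlt => /orP[/cards1P[l ->]|].
    rewrite big_set1 (bigD1 l) //= eqxx.
    have : 0 <= \sum_(l0 < k | l0 != l) (if [set l]%SET == [set l0]%SET then u l0 else 0).
      by apply: sumr_ge0 => m _; case: ifP.
    by case: ifP; lra.
  rewrite ltnS leqn0 finset.cards_eq0 => /eqP J0; move: S0; rewrite J0 finset.big_set0 eqxx; lra.
apply: le_trans (ler_sum _ (fun J _ => bound J)) _.
rewrite !big_split /= -big_mkcond big_pred1_eq.
have cS : #|{set 'I_k}| = (2 ^ k)%N.
  by rewrite -finset.cardsT -finset.powersetT finset.card_powerset finset.cardsT card_ord.
rewrite sumr_const cS exchange_big /=.
have E l : \sum_(J : {set 'I_k}) (if J == [set l]%SET then u l else 0) = u l.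
  by rewrite -big_mkcond big_pred1_eq.
by rewrite (eq_bigr _ (fun l _ => E l)) -[X in _ + X <= _]mulr_natl natrX.
Qed.

(** * Incidence sums over progressions *)

Definition apt {G : zmodType} (i : nat) (ab : G * G) : G := ab.1 + ab.2 *+ i.

Definition aps {G : zmodType} (k : nat) (Omega : set G) : {fset G * G} :=
  fset_set (kAP k Omega).

Definition pts {G : zmodType} (Omega : set G) : {fset G} := fset_set Omega.

(* At most k progressions have given terms at two given positions; the label
   c ab < k separates the progressions sharing these terms. *)
Definition pair_bounded {G : zmodType} (k : nat) (Omega : set G) : Prop :=
  forall i j : nat, (i < j < k)%N -> exists c : G * G -> nat,
    (forall ab, (c ab < k)%N) /\
    (forall x y, kAP k Omega x -> kAP k Omega y ->
       apt i x = apt i y -> apt j x = apt j y -> c x = c y -> x = y).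

(** The weight w of the linear form in the expansion of T_k(p (1 + u)). *)
Definition deg {G : zmodType} {R : realType} (k : nat) (Omega : set G) (x : G) : R :=
  \sum_(i < k) \sum_(ab <- aps k Omega) (apt i ab == x)%:R.

Definition deg2 {G : zmodType} {R : realType} (k : nat) (Omega : set G) : R :=
  \sum_(x <- pts Omega) deg k Omega x ^+ 2.

Section ProgressionSums.
Context {G : zmodType} {R : realType} (k : nat) (Omega : set G).
Hypotheses (k2 : (2 <= k)%N) (finO : finite_set Omega).

(** A progression is determined by its first two terms. *)
Lemma finite_kAP : finite_set (kAP k Omega).
Proof using k2 finO.
apply: (@sub_finite_set _ _ ((fun xy : G * G => (xy.1, xy.2 - xy.1)) @` (Omega `*` Omega))).
  move=> [a b] h; exists (a, a + b) => /=.
    split; first by have := h 0%N (ltnW k2); rewrite mulr0n addr0.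
    by have := h 1%N k2; rewrite mulr1n.
  by rewrite addrAC subrr add0r.
exact/finite_image/finite_setX.
Qed.

Lemma mem_aps (ab : G * G) : ab \in aps k Omega -> kAP k Omega ab.
Proof using k2 finO. by rewrite in_fset_set ?inE //; exact: finite_kAP. Qed.

Lemma in_aps (ab : G * G) : kAP k Omega ab -> ab \in aps k Omega.
Proof using k2 finO. by move=> h; rewrite in_fset_set ?inE //; exact: finite_kAP. Qed.

Lemma mem_pts (x : G) : x \in pts Omega -> Omega x.
Proof using finO. by rewrite in_fset_set // inE. Qed.

Lemma in_pts (x : G) : Omega x -> x \in pts Omega.
Proof using finO. by move=> h; rewrite in_fset_set // inE. Qed.

Lemma apt_pts (i : nat) (ab : G * G) : (i < k)%N -> ab \in aps k Omega ->
  apt i ab \in pts Omega.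
Proof using k2 finO. by move=> ik /mem_aps h; apply: in_pts; exact: h. Qed.

Lemma nAP_sum : (nAP k Omega)%:R = \sum_(ab <- aps k Omega) 1 :> R.
Proof. by rewrite /nAP card_fset_sum1 natr_sum. Qed.

Lemma deg_ge0 (x : G) : 0 <= deg k Omega x :> R.
Proof. by apply: sumr_ge0 => i _; apply: sumr_ge0 => ab _; rewrite ler0n. Qed.

Lemma deg2_ge0 : 0 <= deg2 k Omega :> R.
Proof. by apply: sumr_ge0 => x _; rewrite sqr_ge0. Qed.

Lemma sum_apt (i : nat) (g : G -> R) : (i < k)%N ->
  \sum_(ab <- aps k Omega) g (apt i ab) =
  \sum_(x <- pts Omega) (\sum_(ab <- aps k Omega) (apt i ab == x)%:R) * g x.
Proof using k2 finO.
move=> ik; under [RHS]eq_bigr do rewrite mulr_suml.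
rewrite exchange_big /= big_seq [RHS]big_seq; apply: eq_bigr => ab abA.
by rewrite sum_pred1_seq ?fset_uniq // apt_pts.
Qed.

Lemma sum_deg (g : G -> R) :
  \sum_(x <- pts Omega) deg k Omega x * g x =
  \sum_(i < k) \sum_(ab <- aps k Omega) g (apt i ab).
Proof using k2 finO.
under eq_bigr do rewrite mulr_suml.
rewrite exchange_big /=; apply: eq_bigr => i _.
by rewrite sum_apt.
Qed.

Lemma sum_deg1 : \sum_(x <- pts Omega) deg k Omega x = k%:R * (nAP k Omega)%:R :> R.
Proof using k2 finO.
transitivity (\sum_(x <- pts Omega) deg k Omega x * 1 : R).
  by apply: eq_bigr => x _; rewrite mulr1.
by rewrite sum_deg -nAP_sum sumr_const card_ord mulr_natl.
Qed.

Hypothesis pb : pair_bounded k Omega.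

(** Sending a progression to its two terms and its label is injective, so the sum is part of a
    nonnegative sum over Omega x Omega x [k]; the label accounts for the factor k. *)
Lemma sum_pair_lt (i j : nat) (h1 h2 : G -> R) : (i < j < k)%N ->
  (forall x, Omega x -> 0 <= h1 x) -> (forall x, Omega x -> 0 <= h2 x) ->
  \sum_(ab <- aps k Omega) h1 (apt i ab) * h2 (apt j ab) <=
  k%:R * ((\sum_(x <- pts Omega) h1 x) * (\sum_(x <- pts Omega) h2 x)).
Proof using k2 finO pb.
move=> ijk h10 h20; have [c [ck cinj]] := pb i j ijk.
have [ij jk] := andP ijk; have ik := ltn_trans ij jk.
pose phi (ab : G * G) : G * G * 'I_k := (apt i ab, apt j ab, Ordinal (ck ab)).
pose F (t : G * G * 'I_k) : R := h1 t.1.1 * h2 t.1.2.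
pose s2 := [seq (xy, m) | xy <- [seq (x, y) | x <- pts Omega, y <- pts Omega],
                          m <- index_enum 'I_k].
have -> : \sum_(ab <- aps k Omega) h1 (apt i ab) * h2 (apt j ab) =
    \sum_(t <- [seq phi ab | ab <- aps k Omega]) F t by rewrite big_map.
have -> : k%:R * ((\sum_(x <- pts Omega) h1 x) * (\sum_(x <- pts Omega) h2 x)) =
    \sum_(t <- s2) F t.
  rewrite /s2 big_allpairs_dep /= /F /= big_allpairs_dep /=.
  rewrite big_distrlr /= mulr_sumr; apply: eq_bigr => x _.
  rewrite mulr_sumr; apply: eq_bigr => y _.
  by rewrite sumr_const card_ord mulr_natl.
apply: ler_sum_subset.
- rewrite map_inj_in_uniq ?fset_uniq // => x y /mem_aps hx /mem_aps hy [] e1 e2 e3.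
  exact: cinj.
- move=> _ /mapP[ab abA ->]; apply/allpairsP.
  exists ((apt i ab, apt j ab), Ordinal (ck ab)); split => //=.
    by apply/allpairsP; exists (apt i ab, apt j ab); split => //=; apply: apt_pts.
  by rewrite mem_index_enum.
- move=> _ /allpairsP[[xy m] /= [/allpairsP[[x y] /= [xO yO ->]] _ ->]].
  by rewrite /F /= mulr_ge0 // ?h10 ?h20 //; apply: mem_pts.
Qed.

Lemma sum_pair (i j : nat) (h1 h2 : G -> R) : (i < k)%N -> (j < k)%N -> i != j ->
  (forall x, Omega x -> 0 <= h1 x) -> (forall x, Omega x -> 0 <= h2 x) ->
  \sum_(ab <- aps k Omega) h1 (apt i ab) * h2 (apt j ab) <=
  k%:R * ((\sum_(x <- pts Omega) h1 x) * (\sum_(x <- pts Omega) h2 x)).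
Proof using k2 finO pb.
move=> ik jk; rewrite neq_ltn => /orP[ij|ji] h10 h20.
  by apply: sum_pair_lt; rewrite ?ij.
under eq_bigr do rewrite mulrC; rewrite [X in _ * X]mulrC.
by apply: sum_pair_lt; rewrite ?ji.
Qed.

(** For each i, choose another position j and apply [sum_pair] to the indicator of x and the
    constant 1. *)
Lemma deg_le (x : G) : Omega x ->
  deg k Omega x <= k%:R ^+ 2 * (#|` pts Omega|)%:R :> R.
Proof using k2 finO pb.
move=> Ox; rewrite expr2 -mulrA.
apply: (@le_trans _ _ (\sum_(i < k) (k%:R * (#|` pts Omega|)%:R))); last first.
  by rewrite sumr_const card_ord [leRHS]mulr_natl.
apply: ler_sum => i _.
have [j jk ij] : exists2 j, (j < k)%N & i != j :> nat.
  by case: (eqVneq (i : nat) 0%N) => [->|h]; [exists 1%N|exists 0%N => //; apply: ltnW].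
have := @sum_pair i j (fun y => (y == x)%:R) (fun _ => 1) (ltn_ord i) jk ij
  (fun y _ => ler0n _ _) (fun y _ => ler01).
have -> : \sum_(y <- pts Omega) (y == x)%:R = 1 :> R.
  rewrite -[RHS](@sum_pred1_seq R _ (pts Omega) x (fun=> 1)) ?fset_uniq ?in_pts //.
  by apply: eq_bigr => y _; rewrite mulr1 eq_sym.
rewrite mul1r card_fset_sum1 natr_sum.
by under [X in X <= _ -> _]eq_bigr do rewrite mulr1.
Qed.

(** Cauchy-Schwarz against the constant 1, since the degrees sum to k T. *)
Lemma deg2_lower : (k%:R * (nAP k Omega)%:R) ^+ 2 <=
  (#|` pts Omega|)%:R * deg2 k Omega :> R.
Proof using k2 finO.
rewrite -sum_deg1 card_fset_sum1 natr_sum /deg2.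
by apply: sqr_sum_le => x; rewrite ?ler01 ?sqr_ge0 ?mul1r.
Qed.

(** Sum [prod1D_le] over all progressions; at most k^2 ordered pairs of positions, each with the
    factor k of [sum_pair], give k^3. *)
Lemma nonlinear_le (u : G -> R) : (forall x, Omega x -> 0 <= u x) ->
  \sum_(ab <- aps k Omega) \prod_(i < k) (1 + u (apt i ab)) <=
  (nAP k Omega)%:R + \sum_(x <- pts Omega) deg k Omega x * u x +
  2 ^+ k * k%:R ^+ 3 * (\sum_(x <- pts Omega) psi k (u x)) ^+ 2.
Proof using k2 finO pb.
move=> u0.
have bound ab : ab \in aps k Omega -> \prod_(i < k) (1 + u (apt i ab)) <=
    1 + \sum_(i < k) u (apt i ab) + 2 ^+ k *
    \sum_(i < k) \sum_(j < k | j != i) psi k (u (apt i ab)) * psi k (u (apt j ab)).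
  move=> abA; apply: (@prod1D_le R k (fun i => u (apt i ab)) k2) => i.
  by apply: u0; apply: mem_pts; apply: apt_pts.
rewrite big_seq; apply: le_trans (ler_sum _ bound) _; rewrite -big_seq.
rewrite !big_split /= -nAP_sum sum_deg exchange_big /= lerD2l -mulrA -mulr_sumr.
rewrite ler_pM2l ?exprn_gt0 // exchange_big /=.
set M := \sum_(x <- pts Omega) _.
apply: (@le_trans _ _ (\sum_(i < k) \sum_(j < k) k%:R * M ^+ 2)).
  apply: ler_sum => i _; rewrite exchange_big /=.
  rewrite big_mkcond /=; apply: ler_sum => j _; case: ifP => [ji|_].
    rewrite expr2; apply: sum_pair => //; first by rewrite eq_sym.
      by move=> x Ox; apply/psi_ge0/u0.
    by move=> x Ox; apply/psi_ge0/u0.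
  by rewrite mulr_ge0 ?sqr_ge0.
rewrite !sumr_const !card_ord -mulrnA -[_ *+ (k * k)]mulr_natl natrM.
by rewrite le_eqVlt; apply/orP; left; apply/eqP; ring.
Qed.

End ProgressionSums.

(** * Upper and lower bounds for phi at a fixed N *)

Lemma prod1D_ge {R : realType} (k : nat) (u : 'I_k -> R) : (forall i, 0 <= u i) ->
  1 + \sum_i u i <= \prod_i (1 + u i).
Proof.
elim: k u => [|k IH] u u0; first by rewrite !big_ord0 addr0.
rewrite !big_ord_recr /=.
have h := IH (fun i => u (widen_ord (leqnSn k) i)) (fun i => u0 _).
have s0 : 0 <= \sum_(i < k) u (widen_ord (leqnSn k) i) by apply: sumr_ge0.
have a0 := u0 ord_max.
apply: (@le_trans _ _ ((1 + \sum_(i < k) u (widen_ord (leqnSn k) i)) * (1 + u ord_max))).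
  nra.
by apply: ler_wpM2r => //; rewrite addr_ge0.
Qed.

Lemma min_le_split {R : realType} (a b c : R) : (c < a -> b <= c) -> Num.min a b <= c.
Proof. by move=> h; rewrite ge_min; case: (leP a c) => //= /h. Qed.

Section Bounds.
Context {G : zmodType} {R : realType} (k : nat) (Omega : set G).
Hypotheses (k3 : (3 <= k)%N) (finO : finite_set Omega) (pb : pair_bounded k Omega).
Context (p delta : R).
Hypotheses (hp : 0 < p < 1) (d0 : 0 < delta).

Let k2 : (2 <= k)%N := ltnW k3.
Let N : R := (#|` pts Omega|)%:R.
Let T : R := (nAP k Omega)%:R.
Let S : R := deg2 k Omega.

Lemma Tk_scaled (u : G -> R) : Tk k Omega (fun x => p * (1 + u x)) =
  p ^+ k * \sum_(ab <- aps k Omega) \prod_(i < k) (1 + u (apt i ab)).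
Proof using k3 finO.
rewrite /Tk fsbig_finite ?mulr_sumr; last exact: finite_kAP.
by apply: eq_bigr => ab _; rewrite big_split /= prodr_const card_ord.
Qed.

(** The test function is the equality case of Cauchy-Schwarz, u proportional to [deg], scaled so
    that the linear form equals delta T. The last hypothesis, with [deg_le], keeps its values at
    most 1. *)
Lemma phi_upper : 0 < T -> 0 < S ->
  p * (1 + delta * T / S * (k%:R ^+ 2 * N)) <= 1 ->
  (phi k Omega p delta <=
   (p * (delta ^+ 2 * T ^+ 2 / (2 * S)) * (1 + 2 * p / (1 - p)))%:E)%E.
Proof using k3 finO pb hp d0.
move=> T0 S0 hle; have [p0 p1] := andP hp.
pose u x : R := delta * T / S * deg k Omega x.
have c0 : 0 <= delta * T / S by rewrite divr_ge0 ?mulr_ge0 ?ltW.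
have u0 x : 0 <= u x by rewrite mulr_ge0 ?deg_ge0.
have u1 x : Omega x -> p * (1 + u x) <= 1.
  move=> Ox; apply: le_trans hle; rewrite ler_pM2l // lerD2l ler_wpM2l //.
  exact: deg_le.
apply: (@le_trans _ _ (\sum_(a \in Omega) Irel p (p * (1 + u a)))%:E).
  apply: ereal_inf_lbound; exists (fun x => p * (1 + u x)) => //; split.
    by move=> x Ox; rewrite u1 // andbT mulr_ge0 ?addr_ge0 // ltW.
  rewrite Tk_scaled mulrAC [_ * p ^+ k]mulrC; apply: ler_wpM2l.
    by rewrite exprn_ge0 ?ltW.
  apply: (@le_trans _ _ (\sum_(ab <- aps k Omega) (1 + \sum_(i < k) u (apt i ab)))).
    rewrite big_split /= -nAP_sum exchange_big /= -sum_deg //.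
    have -> : \sum_(x <- pts Omega) deg k Omega x * u x = delta * T.
      transitivity (delta * T / S * \sum_(x <- pts Omega) deg k Omega x ^+ 2).
        by rewrite mulr_sumr; apply: eq_bigr => x _; rewrite /u; ring.
      by rewrite -/(deg2 k Omega) -/S mulfVK ?lt0r_neq0.
    by rewrite -/T; lra.
  by apply: ler_sum => ab _; apply: prod1D_ge.
rewrite lee_fin fsbig_finite //.
apply: (@le_trans _ _ (\sum_(x <- pts Omega) p * (u x ^+ 2 / 2) * (1 + 2 * p / (1 - p)))).
  rewrite big_seq [leRHS]big_seq; apply: ler_sum => x /mem_pts xO.
  by apply: Irel_upper => //; apply/u1/xO.
rewrite -mulr_suml; apply: ler_wpM2r.
  by rewrite addr_ge0 // divr_ge0 ?mulr_ge0 ?ltW // subr_gt0.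
rewrite -mulr_sumr ler_pM2l //.
rewrite (eq_bigr (fun x => (delta * T / S) ^+ 2 / 2 * deg k Omega x ^+ 2)).
  rewrite -mulr_sumr -/(deg2 k Omega) -/S le_eqVlt; apply/orP; left; apply/eqP.
  by field; rewrite lt0r_neq0.
by move=> x _; rewrite /u; ring.
Qed.

Lemma feasible_ge_p (f : G -> R) : (forall a, Omega a -> 0 <= f a <= 1) ->
  (1 + delta) * p ^+ k * T <= Tk k Omega f ->
  exists u : G -> R,
    [/\ forall x, Omega x -> 0 <= u x, forall x, Omega x -> p * (1 + u x) <= 1,
        (1 + delta) * T <= \sum_(ab <- aps k Omega) \prod_(i < k) (1 + u (apt i ab)) &
        p * \sum_(x <- pts Omega) poisson_rate (u x) <= \sum_(a \in Omega) Irel p (f a)].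
Proof using k3 finO hp.
move=> f01 hT; have [p0 p1] := andP hp.
pose u x := Num.max (f x) p / p - 1.
have pu x : p * (1 + u x) = Num.max (f x) p by rewrite /u; field; lra.
have u0 x : 0 <= u x by rewrite /u subr_ge0 ler_pdivlMr // mul1r le_max lexx orbT.
have u1 x : Omega x -> p * (1 + u x) <= 1.
  by move=> /f01 /andP[_ f1]; rewrite pu ge_max f1 ltW.
exists u; split => //.
  rewrite -(ler_pM2l (x := p ^+ k)) ?exprn_gt0 // -Tk_scaled.
  rewrite mulrA [p ^+ k * _]mulrC; apply: le_trans hT _.
  have fk := finite_kAP k Omega k2 finO.
  rewrite /Tk !fsbig_finite //= big_seq [leRHS]big_seq; apply: ler_sum => ab.
  move=> /(mem_aps k Omega k2 finO) abA; apply: ler_prod => i _.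
  have /andP[-> _] /= := f01 _ (abA i (ltn_ord i)).
  by rewrite pu le_max lexx.
rewrite fsbig_finite // mulr_sumr big_seq [leRHS]big_seq; apply: ler_sum => x.
move=> /(mem_pts Omega finO) xO; apply: le_trans (Irel_max _ _ hp (f01 _ xO)).
by rewrite -pu; apply: Irel_lower; rewrite ?u1.
Qed.

Let Lam : R := (Num.sqrt p ^+ (k - 2) * ln (1 / p))^-1.

(** Split at u = 1. Below, [u^2 <= 3 poisson_rate u] and Cauchy-Schwarz give the square root; above,
    [psi_large] applies pointwise. *)
Lemma sum_psi_le (u : G -> R) : (forall x, Omega x -> 0 <= u x) ->
  (forall x, Omega x -> p * (1 + u x) <= 1) ->
  \sum_(x <- pts Omega) psi k (u x) <=
  Num.sqrt (3 * N * \sum_(x <- pts Omega) poisson_rate (u x)) +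
  10 * Lam * \sum_(x <- pts Omega) poisson_rate (u x).
Proof using k3 finO hp.
move=> u0 u1; have [p0 p1] := andP hp.
have Lp : 0 < Num.sqrt p ^+ (k - 2) * ln (1 / p).
  by rewrite mulr_gt0 ?exprn_gt0 ?sqrtr_gt0 // ln_gt0 // div1r invf_gt1.
have L0 : 0 < Lam by rewrite invr_gt0.
(* Truncation by 0 is needed because [sqr_sum_le] asks for its bounds at every point, whereas u is
   controlled on Omega only. *)
pose v x := if (0 <= u x <= 1) then u x else 0.
pose H x := if (0 <= u x) then poisson_rate (u x) else 0.
have H0 x : 0 <= H x by rewrite /H; case: ifP => // /poisson_rate_ge0.
have eqH : \sum_(x <- pts Omega) poisson_rate (u x) = \sum_(x <- pts Omega) H x.
  rewrite big_seq [RHS]big_seq; apply: eq_bigr => x /(mem_pts Omega finO) xO.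
  by rewrite /H u0.
have v0 x : 0 <= v x by rewrite /v; case: ifP => // /andP[].
rewrite eqH; set K := \sum_(x <- pts Omega) H x.
apply: (@le_trans _ _ (\sum_(x <- pts Omega) (v x + 10 * Lam * H x))).
  rewrite big_seq [leRHS]big_seq; apply: ler_sum => x /(mem_pts Omega finO) xO.
  rewrite /v /H u0 //=; case: ifP => [ux|].
    rewrite psi_small ?u0 // lerDl mulr_ge0 ?poisson_rate_ge0 ?u0 //.
    by rewrite mulr_ge0 ?(ltW L0).
  move/negbT; rewrite -ltNge => ux; rewrite add0r.
  have up1 : u x * p <= 1 by have := u1 x xO; lra.
  have := @psi_large R k p (u x) k3 hp (ltW ux) up1.
  by rewrite -ler_pdivlMr // mulrAC.
rewrite big_split /= -mulr_sumr -/K lerD2r.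
have sv : 0 <= \sum_(x <- pts Omega) v x by apply: sumr_ge0.
rewrite -[leLHS]ger0_norm // -sqrtr_sqr ler_wsqrtr //.
have -> : 3 * N * K = (\sum_(x <- pts Omega) 1) * (\sum_(x <- pts Omega) 3 * H x).
  have -> : \sum_(x <- pts Omega) 1 = N :> R by rewrite /N card_fset_sum1 natr_sum.
  by rewrite -mulr_sumr -/K; ring.
apply: sqr_sum_le => x; rewrite ?ler01 ?mulr_ge0 // mul1r /v /H.
have [ux|] := boolP (0 <= u x) => /=; last by rewrite expr0n mulr0.
have h := poisson_rate_ge _ ux; case: ifP => u1x; last first.
  by rewrite expr0n mulr_ge0 // poisson_rate_ge0.
have : u x ^+ 2 / 3 <= u x ^+ 2 / (2 + u x).
  rewrite ler_wpM2l ?sqr_ge0 // lef_pV2 ?posrE; lra.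
lra.
Qed.

(** Cauchy-Schwarz with the weights [deg^2 (2 + u)] and [u^2 / (2 + u)]; the second is at most the
    rate, and the surplus [deg^2 u] in the first is bounded by [deg_le] and [le_psi]. *)
Lemma deg_cauchy (u : G -> R) : (forall x, Omega x -> 0 <= u x) ->
  (\sum_(x <- pts Omega) deg k Omega x * u x) ^+ 2 <=
  (2 * S + (k%:R ^+ 2 * N) ^+ 2 * \sum_(x <- pts Omega) psi k (u x)) *
  \sum_(x <- pts Omega) poisson_rate (u x).
Proof using k3 finO pb.
move=> u0; pose v x := if 0 <= u x then u x else 0.
have v0 x : 0 <= v x by rewrite /v; case: ifP.
have uv x : x \in pts Omega -> u x = v x.
  by move=> /(mem_pts Omega finO) xO; rewrite /v u0.
have -> : \sum_(x <- pts Omega) deg k Omega x * u x = \sum_(x <- pts Omega) deg k Omega x * v x.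
  by rewrite big_seq [RHS]big_seq; apply: eq_bigr => x /uv ->.
apply: (@le_trans _ _ ((\sum_(x <- pts Omega) deg k Omega x ^+ 2 * (2 + v x)) *
    \sum_(x <- pts Omega) v x ^+ 2 / (2 + v x))).
  apply: sqr_sum_le => x.
  - by rewrite mulr_ge0 ?sqr_ge0 ?addr_ge0.
  - by rewrite divr_ge0 ?sqr_ge0 ?addr_ge0.
  - have vx := v0 x; rewrite le_eqVlt; apply/orP; left; apply/eqP; field; lra.
apply: ler_pM.
- by apply: sumr_ge0 => x _; rewrite mulr_ge0 ?sqr_ge0 ?addr_ge0.
- by apply: sumr_ge0 => x _; rewrite divr_ge0 ?sqr_ge0 ?addr_ge0.
- rewrite /S /deg2 !mulr_sumr -big_split /= big_seq [leRHS]big_seq.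
  apply: ler_sum => x xO; rewrite mulrDr [_ * 2]mulrC lerD2l.
  apply: ler_pM; rewrite ?sqr_ge0 ?uv ?le_psi //.
  apply: lerXn2r; rewrite ?nnegrE ?deg_ge0 ?mulr_ge0 ?exprn_ge0 //.
  by apply: deg_le => //; exact: (mem_pts Omega finO).
- rewrite big_seq [leRHS]big_seq; apply: ler_sum => x /uv ->; exact: poisson_rate_ge.
Qed.

End Bounds.
(** The minimum with B disposes of functions of cost at least [B delta^2 N p]; for the others
    [sqrt delta * N * eta] bounds the sum of psi. The square of q is the inverse of the quantity
    assumed to tend to infinity. *)
Lemma phi_lower {G : zmodType} {R : realType} (k : nat) (Omega : set G)
    (p delta B tau : R) :
  let N : R := (#|` pts Omega|)%:R in
  let T : R := (nAP k Omega)%:R in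
  let q := Num.sqrt delta ^+ 3 / (Num.sqrt p ^+ (k - 2) * ln (1 / p)) in
  let eta := Num.sqrt (3 * B * delta) + 10 * B * q in
  (3 <= k)%N -> finite_set Omega -> pair_bounded k Omega ->
  0 < p < 1 -> 0 < delta -> 0 < B -> 0 < tau -> 0 < N -> tau * N ^+ 2 <= T ->
  2 ^+ k * k%:R ^+ 3 / tau * eta ^+ 2 <= 1 ->
  ((delta ^+ 2 * N * p * Num.min B
     ((1 - 2 ^+ k * k%:R ^+ 3 / tau * eta ^+ 2) ^+ 2 /
      (deg2 k Omega * N / T ^+ 2 *
       (2 + k%:R ^+ 2 / tau ^+ 2 * (Num.sqrt delta * eta)))))%:E
   <= phi k Omega p delta)%E.
Proof.
move=> N T q eta k3 finO pb hp d0 B0 tau0 N0 hT heta.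
have k2 : (2 <= k)%N by exact: ltnW.
have [p0 p1] := andP hp.
have T0 : 0 < T by apply: lt_le_trans hT; rewrite mulr_gt0 ?exprn_gt0.
have k0 : 0 < k%:R :> R by rewrite ltr0n; apply: ltnW.
have S2 : (k%:R * T) ^+ 2 <= N * deg2 k Omega by exact: deg2_lower.
have S0 : 0 < deg2 k Omega :> R.
  rewrite -(pmulr_rgt0 _ N0); apply: lt_le_trans S2.
  by rewrite exprn_gt0 ?mulr_gt0.
have sd0 : 0 < Num.sqrt delta by rewrite sqrtr_gt0.
have L0 : 0 < Num.sqrt p ^+ (k - 2) * ln (1 / p).
  by rewrite mulr_gt0 ?exprn_gt0 ?sqrtr_gt0 // ln_gt0 // div1r invf_gt1.
have q0 : 0 < q by rewrite divr_gt0 ?exprn_gt0.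
have eta0 : 0 < eta.
  by apply: ltr_wpDl; rewrite ?sqrtr_ge0 // mulr_gt0 // mulr_gt0.
apply/ereal_infP => _ [f [f01 hf] <-]; rewrite lee_fin.
have [u [u0 u1 hu hK]] := feasible_ge_p k Omega k3 finO p delta hp f f01 hf.
apply: le_trans hK; rewrite [_ * p]mulrC -[leLHS]mulrA ler_pM2l //.
set K := \sum_(x <- pts Omega) poisson_rate (u x).
have K0 : 0 <= K.
  rewrite /K big_seq; apply: sumr_ge0 => x /(mem_pts Omega finO) xO.
  by apply: poisson_rate_ge0; exact: u0.
rewrite mulrC -ler_pdivlMr ?mulr_gt0 ?exprn_gt0 //.
apply: min_le_split; rewrite ltr_pdivrMr ?mulr_gt0 ?exprn_gt0 // => KB.
pose M := \sum_(x <- pts Omega) psi k (u x).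
have M0 : 0 <= M.
  rewrite /M big_seq; apply: sumr_ge0 => x /(mem_pts Omega finO) xO.
  by apply: psi_ge0; exact: u0.
have hM : M <= Num.sqrt delta * N * eta.
  apply: le_trans (sum_psi_le k Omega k3 finO p hp u u0 u1) _.
  rewrite -/N -/K /eta mulrDr; apply: lerD.
    have -> : Num.sqrt delta * N * Num.sqrt (3 * B * delta) = Num.sqrt (3 * N * (B * (delta ^+ 2 * N))).
      rewrite mulrAC -sqrtrM ?ltW // -{1}(ger0_norm (ltW N0)) -sqrtr_sqr -sqrtrM.
        by congr Num.sqrt; ring.
      by rewrite !mulr_ge0 ?ltW.
    by rewrite ler_wsqrtr // ler_wpM2l ?mulr_ge0 ?ltW.
  apply: (@le_trans _ _ (10 * (Num.sqrt p ^+ (k - 2) * ln (1 / p))^-1 * (B * (delta ^+ 2 * N)))).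
    by rewrite ler_wpM2l ?ltW // ?mulr_gt0 ?invr_gt0.
  rewrite le_eqVlt; apply/orP; left; apply/eqP.
  have -> : delta ^+ 2 = Num.sqrt delta * Num.sqrt delta ^+ 3.
    by rewrite -exprS -[in LHS](sqr_sqrtr (ltW d0)) -exprM.
  by rewrite /q; ring.
(* E bounds the share of the excess delta T due to nonlinear terms; F is the error added to the
   factor 2 in [deg_cauchy]. *)
pose E := 2 ^+ k * k%:R ^+ 3 / tau * eta ^+ 2.
pose F := k%:R ^+ 2 / tau ^+ 2 * (Num.sqrt delta * eta).
have F0 : 0 <= F by rewrite /F !mulr_ge0 ?invr_ge0 ?exprn_ge0 ?ltW.
have C0 : 0 < 2 ^+ k * k%:R ^+ 3 :> R by rewrite mulr_gt0 ?exprn_gt0.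
have lin : delta * T * (1 - E) <= \sum_(x <- pts Omega) deg k Omega x * u x.
  have := nonlinear_le k Omega k2 finO pb u u0.
  rewrite -/M -/T => nl.
  have : 2 ^+ k * k%:R ^+ 3 * M ^+ 2 <= delta * T * E.
    apply: (@le_trans _ _ (2 ^+ k * k%:R ^+ 3 * (Num.sqrt delta * N * eta) ^+ 2)).
      rewrite ler_pM2l //; apply: lerXn2r => //; rewrite nnegrE //.
      by rewrite !mulr_ge0 ?ltW.
    have -> : (Num.sqrt delta * N * eta) ^+ 2 = delta * N ^+ 2 * eta ^+ 2.
      by rewrite !exprMn sqr_sqrtr ?ltW.
    have -> : delta * T * E = 2 ^+ k * k%:R ^+ 3 * (delta * (T / tau) * eta ^+ 2).
      by rewrite /E; field; lra.
    rewrite ler_pM2l // ler_wpM2r ?sqr_ge0 // ler_wpM2l ?(ltW d0) //.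
    by rewrite ler_pdivlMr // mulrC.
  lra.
have cs := deg_cauchy k Omega k3 finO pb u u0.
rewrite -/N -/M -/K in cs.
have quad : 2 * deg2 k Omega + (k%:R ^+ 2 * N) ^+ 2 * M <= deg2 k Omega * (2 + F).
  rewrite mulrDr [_ * 2]mulrC lerD2l.
  apply: (@le_trans _ _ ((k%:R ^+ 2 * N) ^+ 2 * (Num.sqrt delta * N * eta))).
    by rewrite ler_wpM2l ?sqr_ge0.
  have -> : (k%:R ^+ 2 * N) ^+ 2 * (Num.sqrt delta * N * eta) =
     (k%:R ^+ 2 * tau ^+ 2 * N ^+ 3) * F by rewrite /F; field; lra.
  (* It remains that [k^2 tau^2 N^3 <= deg2], which follows from [deg2_lower] and [tau N^2 <= T]. *)
  apply: ler_wpM2r => //; rewrite -(ler_pM2l N0); apply: le_trans S2.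
  have -> : N * (k%:R ^+ 2 * tau ^+ 2 * N ^+ 3) = (k%:R * (tau * N ^+ 2)) ^+ 2 by ring.
  apply: lerXn2r; rewrite ?nnegrE ?ler_pM2l //.
    by rewrite !mulr_ge0 ?exprn_ge0 ?ltW.
  by rewrite mulr_ge0 ?ltW.
have sq : (delta * T * (1 - E)) ^+ 2 <= deg2 k Omega * (2 + F) * K.
  apply: le_trans (_ : _ <= (\sum_(x <- pts Omega) deg k Omega x * u x) ^+ 2) _.
    have E1 : 0 <= delta * T * (1 - E) by rewrite mulr_ge0 ?subr_ge0 // mulr_ge0 ?ltW.
    by apply: lerXn2r; rewrite ?nnegrE //; apply: le_trans lin.
  by apply: le_trans cs _; rewrite ler_wpM2r.
rewrite -/E -/F ler_pdivlMr ?mulr_gt0 ?exprn_gt0 //.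
have F2 : 0 < 2 + F by lra.
have -> : (1 - E) ^+ 2 / (deg2 k Omega * N / T ^+ 2 * (2 + F)) * (delta ^+ 2 * N) =
  (delta * T * (1 - E)) ^+ 2 / (deg2 k Omega * (2 + F)).
  by field; rewrite !lt0r_neq0.
by rewrite ler_pdivrMr ?mulr_gt0 // [leRHS]mulrC.
Qed.

(** * Passage to the limit for a general family of sets *)

Lemma cvg0_of_expr {R : realType} (u : nat -> R) (n : nat) :
  (\forall N \near \oo, 0 <= u N) -> u N ^+ n.+1 @[N --> \oo] --> (0 : R) ->
  u N @[N --> \oo] --> (0 : R).
Proof.
move=> u0 /cvgrPdist_lt h; apply/cvgrPdist_lt => e e0.
have en : 0 < e ^+ n.+1 by rewrite exprn_gt0.
near=> N.
have uN : 0 <= u N by near: N.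
have : `|0 - u N ^+ n.+1| < e ^+ n.+1 by near: N; exact: h.
rewrite !sub0r !normrN !ger0_norm ?exprn_ge0 //.
by rewrite ltr_pXn2r // nnegrE // ltW.
Unshelve. all: by end_near. Qed.

Lemma cvg_min_const {R : realType} (B : R) (v : nat -> R) :
  v N @[N --> \oo] --> B -> Num.min B (v N) @[N --> \oo] --> B.
Proof.
move=> /cvgrPdist_lt h; apply/cvgrPdist_lt => e e0; near=> N.
have : `|B - v N| < e by near: N; exact: h.
by case: (leP B (v N)) => // _; rewrite subrr normr0.
Unshelve. all: by end_near. Qed.

Lemma cvg_pow {R : realType} (u : nat -> R) (a : R) (n : nat) :
  u N @[N --> \oo] --> a -> u N ^+ n @[N --> \oo] --> a ^+ n.
Proof.
move=> h; elim: n => [|n IH].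
  by under eq_cvg do rewrite expr0; rewrite expr0; exact: cvg_cst.
under eq_cvg do rewrite exprS; rewrite exprS; exact: cvgM.
Qed.

(** With s = sqrt p, [s ln (1/p) = 2 s ln (1/s) <= 2]. The bound serves to deduce that delta tends
    to 0. *)
Lemma pow_ln_le {R : realType} (p : R) (m : nat) : 0 < p < 1 -> (0 < m)%N ->
  p ^+ m * ln (1 / p) ^+ 2 <= 4.
Proof.
move=> /andP[p0 p1] m0.
have L0 : 0 <= ln (1 / p) by apply: ln_ge0; rewrite div1r invf_ge1 // ltW.
set s := Num.sqrt p; have s0 : 0 < s by rewrite sqrtr_gt0.
have e : ln (1 / p) = 2 * ln s^-1.
  rewrite -[p in LHS](sqr_sqrtr (ltW p0)) -/s div1r -exprVn lnXn ?invr_gt0 //.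
  by rewrite mulr_natl.
have h : s * ln (1 / p) <= 2.
  have : ln s^-1 <= s^-1 by apply/ltW/ln_sublinear; rewrite invr_gt0.
  move/(ler_wpM2l (ltW s0)); rewrite mulfV ?lt0r_neq0 // e; lra.
apply: (@le_trans _ _ (p * ln (1 / p) ^+ 2)).
  apply: ler_wpM2r; first exact: sqr_ge0.
  by rewrite -[leRHS]expr1; apply: ler_wiXn2l => //; exact: ltW.
rewrite -[X in X * _](sqr_sqrtr (ltW p0)) -/s -exprMn.
have -> : 4 = 2 ^+ 2 :> R by ring.
by apply: lerXn2r; rewrite ?nnegrE // mulr_ge0 // ltW.
Qed.

(** After division by [delta^2 N p], the bounds of [phi_lower] and [phi_upper] both tend to 1 / (2
    Gamma). *)
Lemma phi_asymp {R : realType} (k : nat) (G : nat -> zmodType)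
    (Omega : forall N, set (G N)) (Gamma tau : R) (p delta : nat -> R) :
  (3 <= k)%N ->
  (forall N : nat, (0 < N)%N -> 0 < p N < 1) ->
  (forall N : nat, (0 < N)%N -> 0 < delta N) ->
  p N @[N --> \oo] --> (0 : R) ->
  delta N ^- 3 * p N ^+ (k - 2)%N * ln (1 / p N) ^+ 2 @[N --> \oo] --> +oo ->
  0 < Gamma -> 0 < tau ->
  (\forall N \near \oo, [/\ finite_set (Omega N), pair_bounded k (Omega N),
     #|` pts (Omega N)| = N & tau * N%:R ^+ 2 <= (nAP k (Omega N))%:R]) ->
  deg2 k (Omega N) * N%:R / (nAP k (Omega N))%:R ^+ 2 @[N --> \oo] --> Gamma ->
  asymp (fun N => phi k (Omega N) (p N) (delta N)) (1 / (2 * Gamma))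
    (fun N => delta N ^+ 2 * N%:R * p N).
Proof.
move=> k3 hp hd p_0 hlim Gam0 tau0 hO hR.
set X := fun N : nat => delta N ^- 3 * p N ^+ (k - 2)%N * ln (1 / p N) ^+ 2 in hlim.
have X0 N : (0 < N)%N -> 0 < X N.
  move=> N0; have /andP[p0 p1] := hp N N0; have d0 := hd N N0.
  rewrite /X !mulr_gt0 ?invr_gt0 ?exprn_gt0 // ln_gt0 // div1r invf_gt1 //.
have XV : (X N)^-1 @[N --> \oo] --> (0 : R).
  apply/gtr0_cvgV0 => //; near=> N; apply: X0; near: N; exact: nbhs_infty_gt.
have d_0 : delta N @[N --> \oo] --> (0 : R).
  apply: (@cvg0_of_expr _ _ 2).
    near=> N; apply/ltW/hd; near: N; exact: nbhs_infty_gt.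
  apply: (@squeeze_cvgr _ _ _ _ (fun=> 0) (fun N => 4 * (X N)^-1)).
  - near=> N; have N0 : (0 < N)%N by near: N; exact: nbhs_infty_gt.
    have d0 := hd N N0; rewrite exprn_ge0 ?(ltW d0) //=.
    rewrite ler_pdivlMr ?X0 // /X /=.
    have -> : delta N ^+ 3 * (delta N ^- 3 * p N ^+ (k - 2) * ln (1 / p N) ^+ 2) =
      p N ^+ (k - 2) * ln (1 / p N) ^+ 2 by field; rewrite lt0r_neq0.
    by apply: pow_ln_le; rewrite ?hp ?subn_gt0.
  - exact: cvg_cst.
  - by rewrite -[X in _ --> X](mulr0 4); apply: cvgM => //; exact: cvg_cst.
(* The limit itself can serve as the threshold of [phi_lower]: the minimum of B and a sequence
   tending to B still tends to B. *)
pose B : R := 1 / (2 * Gamma).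
have B0 : 0 < B by rewrite divr_gt0 // mulr_gt0.
pose q N := Num.sqrt (delta N) ^+ 3 / (Num.sqrt (p N) ^+ (k - 2) * ln (1 / p N)).
have q_0 : q N @[N --> \oo] --> (0 : R).
  apply: (@cvg0_of_expr _ _ 1).
    near=> N; have N0 : (0 < N)%N by near: N; exact: nbhs_infty_gt.
    have /andP[p0 p1] := hp N N0.
    rewrite /q divr_ge0 ?mulr_ge0 ?exprn_ge0 ?sqrtr_ge0 // ln_ge0 //.
    by rewrite div1r invf_ge1 // ltW.
  apply: cvg_trans XV; apply: near_eq_cvg; near=> N.
  have N0 : (0 < N)%N by near: N; exact: nbhs_infty_gt.
  have /andP[p0 p1] := hp N N0; have d0 := hd N N0.
  have l0 : ln (1 / p N) != 0 by rewrite lt0r_neq0 // ln_gt0 // div1r invf_gt1.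
  have a0 : Num.sqrt (delta N) != 0 by rewrite lt0r_neq0 // sqrtr_gt0.
  have c0 : Num.sqrt (p N) ^+ (k - 2) != 0 by rewrite expf_neq0 // lt0r_neq0 // sqrtr_gt0.
  rewrite /q /X; move: l0 a0 c0; set l := ln _; set a := Num.sqrt _ => l0 a0.
  have -> : p N ^+ (k - 2) = (Num.sqrt (p N) ^+ (k - 2)) ^+ 2.
    by rewrite exprAC sqr_sqrtr ?ltW.
  set c := _ ^+ (k - 2) => c0.
  have -> : delta N = a ^+ 2 by rewrite sqr_sqrtr ?ltW.
  field.
  by rewrite l0 a0 c0.
pose eta N := Num.sqrt (3 * B * delta N) + 10 * B * q N.
have sqrt0 (u : nat -> R) : (\forall N \near \oo, 0 <= u N) ->
    u N @[N --> \oo] --> (0 : R) -> Num.sqrt (u N) @[N --> \oo] --> (0 : R).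
  move=> u0 hu; apply: (@cvg0_of_expr _ _ 1).
    by near=> N; exact: sqrtr_ge0.
  apply: cvg_trans hu; apply: near_eq_cvg; near=> N.
  by rewrite sqr_sqrtr //; near: N.
have eta_0 : eta N @[N --> \oo] --> (0 : R).
  rewrite -[X in _ --> X]addr0; apply: cvgD.
    apply: sqrt0.
      near=> N; have N0 : (0 < N)%N by near: N; exact: nbhs_infty_gt.
      apply: mulr_ge0; last exact/ltW/hd.
      by apply: mulr_ge0 => //; exact: ltW.
    by rewrite -[X in _ --> X](mulr0 (3 * B)); apply: cvgM => //; exact: cvg_cst.
  by rewrite -[X in _ --> X](mulr0 (10 * B)); apply: cvgM => //; exact: cvg_cst.
pose C : R := 2 ^+ k * k%:R ^+ 3 / tau.
pose D : R := k%:R ^+ 2 / tau ^+ 2.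
have Ceta : C * eta N ^+ 2 @[N --> \oo] --> (0 : R).
  rewrite -[X in _ --> X](mulr0 C); apply: cvgM; first exact: cvg_cst.
  by rewrite -[X in _ --> X](expr0n R 2); exact: cvg_pow.
pose Rr N : R := deg2 k (Omega N) * N%:R / (nAP k (Omega N))%:R ^+ 2.
pose L N := Num.min B ((1 - C * eta N ^+ 2) ^+ 2 /
  (Rr N * (2 + D * (Num.sqrt (delta N) * eta N)))).
pose U N := (2 * Rr N)^-1 * (1 + 2 * p N / (1 - p N)).
have L_lim : L N @[N --> \oo] --> B.
  apply: cvg_min_const.
  have -> : B = (1 - 0) ^+ 2 / (Gamma * (2 + D * (0 * 0))).
    by rewrite /B subr0 expr1n mul0r mulr0 addr0 mulrC [Gamma * 2]mulrC mulrC.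
  apply: cvgM; first by apply: cvg_pow; apply: cvgB => //; exact: cvg_cst.
  apply: cvgV; first by rewrite mul0r mulr0 addr0 mulf_neq0 ?lt0r_neq0.
  apply: cvgM => //; apply: cvgD; first exact: cvg_cst.
  apply: cvgM; first exact: cvg_cst.
  apply: cvgM => //; apply: sqrt0 => //.
  near=> N; apply/ltW/hd; near: N; exact: nbhs_infty_gt.
have U_lim : U N @[N --> \oo] --> B.
  have -> : B = (2 * Gamma)^-1 * (1 + 2 * 0 / (1 - 0)).
    by rewrite /B mulr0 mul0r addr0 mulr1 div1r.
  apply: cvgM.
    apply: cvgV; first by rewrite mulf_neq0 ?lt0r_neq0.
    by apply: cvgM => //; exact: cvg_cst.
  apply: cvgD; first exact: cvg_cst.
  apply: cvgM; first by apply: cvgM => //; exact: cvg_cst.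
  apply: cvgV; first by rewrite subr0 oner_neq0.
  by apply: cvgB => //; exact: cvg_cst.
pose v N : R := delta N ^+ 2 * N%:R * p N.
have main : \forall N \near \oo, [/\ 0 < v N, ((v N * L N)%:E <= phi k (Omega N) (p N) (delta N))%E &
    (phi k (Omega N) (p N) (delta N) <= (v N * U N)%:E)%E].
  have Ceta1 : \forall N \near \oo, C * eta N ^+ 2 <= 1.
    by apply: cvgr_le Ceta _ _ => //; exact: ltr01.
  have d1 : \forall N \near \oo, delta N <= tau.
    by apply: cvgr_le d_0 _ _.
  have p1 : \forall N \near \oo, p N <= 2^-1.
    by apply: cvgr_le p_0 _ _; rewrite ?invr_gt0.
  near=> N; have N0 : (0 < N)%N by near: N; exact: nbhs_infty_gt.
  have [finO pb cardO hT] : [/\ finite_set (Omega N), pair_bounded k (Omega N),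
     #|` pts (Omega N)| = N & tau * N%:R ^+ 2 <= (nAP k (Omega N))%:R] by near: N.
  have /andP[pp0 pp1] := hp N N0; have d0 := hd N N0.
  have NR : 0 < N%:R :> R by rewrite ltr0n.
  split; first by rewrite !mulr_gt0 ?exprn_gt0.
    rewrite /v /L /Rr.
    have := @phi_lower (G N) R k (Omega N) (p N) (delta N) B tau k3 finO pb (hp N N0) d0 B0 tau0.
    by rewrite cardO; apply => //; near: N.
  have fT : 0 < (nAP k (Omega N))%:R :> R.
    by apply: lt_le_trans hT; rewrite mulr_gt0 ?exprn_gt0.
  have k2 := ltnW k3; have k0 : 0 < k%:R :> R by rewrite ltr0n; apply: ltnW.
  have hS := @deg2_lower (G N) R k (Omega N) k2 finO; rewrite cardO in hS.
  have S0 : 0 < deg2 k (Omega N) :> R.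
    by rewrite -(pmulr_rgt0 _ NR); apply: lt_le_trans hS; rewrite exprn_gt0 ?mulr_gt0.
  have := @phi_upper (G N) R k (Omega N) k3 finO pb (p N) (delta N) (hp N N0) d0 fT S0.
  rewrite cardO.
  have -> : p N * (delta N ^+ 2 * (nAP k (Omega N))%:R ^+ 2 / (2 * deg2 k (Omega N))) *
     (1 + 2 * p N / (1 - p N)) = v N * U N.
    rewrite /v /U /Rr [RHS]mulrA; congr (_ * _); field.
    by rewrite !lt0r_neq0.
  (* By [deg2_lower], the maximal deviation [delta T k^2 N / deg2] is at most
     [delta N^2 / T <= delta / tau <= 1], and p <= 1/2. *)
  apply; apply: (@le_trans _ _ (2^-1 * (1 + 1))); last by lra.
  have dt : delta N <= tau by near: N.
  have p2 : p N <= 2^-1 by near: N.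
  apply: ler_pM => //; first exact: ltW.
    by rewrite addr_ge0 // !mulr_ge0 ?invr_ge0 ?ltW // exprn_ge0 // ltW.
  rewrite lerD2l mulrAC ler_pdivrMr // mul1r.
  rewrite -(ler_pM2r NR) -(ler_pM2r NR).
  set T : R := (nAP k (Omega N))%:R in hT fT hS *.
  apply: (@le_trans _ _ (k%:R ^+ 2 * T * (tau * N%:R ^+ 2) * N%:R)).
    have -> : delta N * T * (k%:R ^+ 2 * N%:R) * N%:R * N%:R =
       (k%:R ^+ 2 * T) * (delta N * N%:R ^+ 2) * N%:R by ring.
    by rewrite ler_pM2r // ler_pM2l ?mulr_gt0 ?exprn_gt0 // ler_pM2r ?exprn_gt0.
  rewrite ler_pM2r // [leRHS]mulrC; apply: le_trans hS.
  have -> : (k%:R * T) ^+ 2 = k%:R ^+ 2 * T * T by ring.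
  by rewrite ler_pM2l ?mulr_gt0 ?exprn_gt0.
(* Both bounds are finite, so eventually [fine] does not take its default value. *)
exists (fun N => fine (phi k (Omega N) (p N) (delta N)) / v N - B).
  rewrite -(subrr B); apply: cvgB; last exact: cvg_cst.
  apply: (@squeeze_cvgr _ _ _ _ L U) => //; near=> N.
  have [v0 hL hU] : [/\ 0 < v N, ((v N * L N)%:E <= phi k (Omega N) (p N) (delta N))%E &
    (phi k (Omega N) (p N) (delta N) <= (v N * U N)%:E)%E] by near: N.
  rewrite ler_pdivlMr // ler_pdivrMr // ![_ * v N]mulrC.
  by move: hL hU; case: (phi _ _ _ _) => //= r; rewrite !lee_fin => -> ->.
near=> N.
have [v0 hL hU] : [/\ 0 < v N, ((v N * L N)%:E <= phi k (Omega N) (p N) (delta N))%E &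
    (phi k (Omega N) (p N) (delta N) <= (v N * U N)%:E)%E] by near: N.
rewrite -/B addrC subrK -/(v N) divfK ?lt0r_neq0 //.
by move: hL hU; case: (phi _ _ _ _).
Unshelve. all: by end_near. Qed.

(** * The cyclic group *)

Lemma perm_fset_setT {T : finType} : perm_eq (fset_set [set: T]) (index_enum T).
Proof.
apply: uniq_perm; rewrite ?fset_uniq ?index_enum_uniq // => x.
by rewrite (in_fset_set finite_finset) mem_index_enum; exact/mem_set.
Qed.

Lemma card_fset_setT {T : finType} : #|` fset_set [set: T]| = #|T|.
Proof. by rewrite -sum1_size (perm_big _ perm_fset_setT) /= sum1_card. Qed.

Lemma kAP_setT {G : zmodType} (k : nat) : kAP k [set: G] = setT.
Proof. by apply/seteqP; split. Qed.

Lemma cyclic_nAP (k n : nat) : nAP k (cyclic n.+2) = (n.+2 * n.+2)%N.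
Proof.
by rewrite /nAP /cyclic kAP_setT card_fset_setT card_prod !card_ord.
Qed.

Lemma cyclic_pts (n : nat) : #|` pts (cyclic n.+2)| = n.+2.
Proof. by rewrite /pts /cyclic card_fset_setT card_ord. Qed.

(** For each position and each difference exactly one starting point puts x there. *)
Lemma cyclic_deg {R : realType} (k n : nat) (x : 'Z_n.+2) :
  deg k (cyclic n.+2) x = k%:R * n.+2%:R :> R.
Proof.
rewrite /deg /aps /cyclic kAP_setT.
rewrite (eq_bigr (fun=> n.+2%:R)) ?sumr_const ?card_ord ?mulr_natl // => i _.
rewrite (perm_big _ perm_fset_setT) /=.
transitivity (\sum_(ab : 'Z_n.+2 * 'Z_n.+2) (apt i (ab.1, ab.2) == x)%:R : R).
  by apply: eq_bigr => -[].
rewrite -(pair_bigA _ (fun a b => (apt i (a, b) == x)%:R)) exchange_big /=.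
rewrite (eq_bigr (fun=> 1)) ?sumr_const ?card_ord // => b _.
rewrite (bigD1 (x - b *+ i)) //= /apt /= subrK eqxx big1 ?addr0 // => a ax.
by rewrite eq_sym -subr_eq eq_sym (negbTE ax).
Qed.

Lemma cyclic_deg2 {R : realType} (k n : nat) :
  deg2 k (cyclic n.+2) = n.+2%:R * (k%:R * n.+2%:R) ^+ 2 :> R.
Proof.
rewrite -[X in X%:R * _](cyclic_pts n) card_fset_sum1 natr_sum mulr_suml.
by apply: eq_bigr => x _; rewrite cyclic_deg mul1r.
Qed.

(* The solutions b of d b = c in Z/NZ are told apart by the quotient of d b by
   N, which is less than d. *)
Lemma cyclic_pair_bounded (k n : nat) : pair_bounded k (cyclic n.+2).
Proof.
move=> i j /andP[ij jk].
exists (fun ab => ((j - i) * val ab.2) %/ n.+2)%N; split.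
  move=> ab; rewrite ltn_divLR // (leq_ltn_trans (n := (j - i) * n.+2)%N) //.
    by rewrite leq_mul2l; apply/orP; right; apply/ltnW/(ltn_ord ab.2).
  by rewrite ltn_mul2r /=; lia.
move=> [a b] [a' b'] _ _; rewrite /apt /= => e1 e2 e3.
have eb : b *+ (j - i) = b' *+ (j - i).
  rewrite !mulrnBr ?(ltnW ij) //.
  have -> : b *+ j - b *+ i = (a + b *+ j) - (a + b *+ i).
    by rewrite opprD addrACA subrr add0r.
  by rewrite e1 e2 opprD addrACA subrr add0r.
move: eb; rewrite !Zp_mulrn => /(congr1 val) /= em.
have bb : b = b'.
  apply: val_inj => /=; apply/eqP.
  rewrite -(@eqn_pmul2l (j - i)) ?subn_gt0 //; apply/eqP.
  rewrite (divn_eq ((j - i) * b) n.+2) (divn_eq ((j - i) * b') n.+2) e3.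
  by rewrite [((j - i) * b)%N]mulnC [((j - i) * b')%N]mulnC em.
by move: e1; rewrite bb => /addIr ->.
Qed.

(** Here T = N^2 and deg2 = k^2 N^3, so Gamma = k^2 and tau = 1. *)
Lemma cyclic_asymp {R : realType} (k : nat) (p delta : nat -> R) : (3 <= k)%N ->
  (forall N : nat, (0 < N)%N -> 0 < p N < 1) ->
  (forall N : nat, (0 < N)%N -> 0 < delta N) ->
  p N @[N --> \oo] --> (0 : R) ->
  delta N ^- 3 * p N ^+ (k - 2)%N * ln (1 / p N) ^+ 2 @[N --> \oo] --> +oo ->
  asymp (fun N => phi k (cyclic N) (p N) (delta N)) (1 / (2 * k%:R ^+ 2))
    (fun N => delta N ^+ 2 * N%:R * p N).
Proof.
move=> k3 hp hd p_0 hlim.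
have k0 : 0 < k%:R :> R by rewrite ltr0n; apply: leq_trans k3.
apply: (@phi_asymp R k (fun N => 'Z_N : zmodType) cyclic _ 1) => //.
- by rewrite exprn_gt0.
- exists 2%N => // -[|[|n]] // _; split.
  + exact: finite_finset.
  + exact: cyclic_pair_bounded.
  + exact: cyclic_pts.
  + by rewrite cyclic_nAP mul1r natrM expr2.
- have h : (fun=> k%:R ^+ 2) N @[N --> \oo] --> (k%:R ^+ 2 : R) by exact: cvg_cst.
  apply: cvg_trans h; apply: near_eq_cvg.
  exists 2%N => // -[|[|n]] // _; rewrite cyclic_deg2 cyclic_nAP natrM.
  by field; rewrite lt0r_neq0.
Qed.

(** * Counting progressions in an interval *)

Lemma seg_finite (N : nat) : finite_set (seg N).
Proof.
apply: (@sub_finite_set _ _ [set` [seq Posz x | x <- index_iota 1 N.+1]]) => //.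
move=> x /andP[x1 xN]; apply/mapP; exists `|x|%N; rewrite ?mem_index_iota; lia.
Qed.

Lemma seg_pts_perm (N : nat) :
  perm_eq (pts (seg N)) [seq Posz x | x <- index_iota 1 N.+1].
Proof.
apply: uniq_perm; rewrite ?fset_uniq ?map_inj_uniq ?iota_uniq //.
  by move=> ? ? [].
move=> x; rewrite in_fset_set; last exact: seg_finite.
apply/idP/mapP.
  rewrite inE => /andP[x1 xN]; exists `|x|%N; rewrite ?mem_index_iota; lia.
by move=> [y]; rewrite mem_index_iota => /andP[y1 yN] ->; rewrite inE /seg /=; lia.
Qed.

Lemma seg_pts (N : nat) : #|` pts (seg N)| = N.
Proof. by rewrite (perm_size (seg_pts_perm N)) size_map size_iota subn1. Qed.

Lemma sum_seg {R : realType} (N : nat) (F : int -> R) :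
  \sum_(x <- pts (seg N)) F x = \sum_(1 <= x < N.+1) F (Posz x).
Proof. by rewrite (perm_big _ (seg_pts_perm N)) big_map. Qed.

Lemma apt_int (i : nat) (ab : int * int) : apt i ab = ab.1 + ab.2 * i%:Z.
Proof. by rewrite /apt -mulr_natr natz. Qed.

Lemma int_pair_bounded (k : nat) (Omega : set int) : pair_bounded k Omega.
Proof.
move=> i j /andP[ij jk]; exists (fun=> 0%N); split=> [_|]; first by apply: leq_trans jk.
move=> [a b] [a' b'] _ _; rewrite !apt_int /= => e1 e2 _.
have : (b - b') * (j%:Z - i%:Z) = 0.
  have -> : (b - b') * (j%:Z - i%:Z) = ((a + b * j%:Z) - (a + b * i%:Z)) -
    ((a' + b' * j%:Z) - (a' + b' * i%:Z)) by ring.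
  by rewrite e1 e2 subrr.
move=> /eqP; rewrite mulf_eq0 !subr_eq0 => /orP[/eqP bb|/eqP [ji]]; last first.
  by rewrite ji ltnn in ij.
by move: e1; rewrite bb => /addIr ->.
Qed.

Lemma seg_kAPP (n N : nat) (ab : int * int) : (0 < n)%N ->
  kAP n.+1 (seg N) ab <->
  1 <= ab.1 <= N%:Z /\ 1 <= ab.1 + ab.2 * n%:Z <= N%:Z.
Proof.
case: ab => a b n0 /=; split=> [h|[/andP[h1 h2] /andP[h3 h4]] i].
  have := h 0%N isT; have := h n (ltnSn n); rewrite /seg /= mulr0n addr0.
  by rewrite -mulr_natr natz.
rewrite ltnS => lin; rewrite /seg /= -mulr_natr natz.
have n0' : 0 < n%:Z by [].
have [m nE] : exists m : nat, n = (i + m)%N by exists (n - i)%N; rewrite subnKC.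
(* By convexity the end terms suffice: [n (a + i b) = (n - i) a + i (a + n b)]. *)
apply/andP; split; rewrite -(ler_pM2l n0'); subst n; nia.
Qed.

(* For N = n q, the number of b > 0 such that the (n+1)-term progression with
   difference b and i-th term x stays in [1, N].  Taking n | N puts the
   crossover x / i = (N - x) / (n - i) at the integer i q. *)
Definition reach (n q i x : nat) : nat :=
  if (x <= i * q)%N then (x.-1 %/ i)%N else ((n * q - x) %/ (n - i))%N.

(** The comparison of x with i q tells which of the two constraints implies the other. The divisor
    is never 0: x >= 1 excludes the first branch for i = 0, and x <= n q the second for i = n. *)
Lemma reachP (n q i x b : nat) : (0 < n)%N -> (i <= n)%N -> (1 <= x <= n * q)%N ->
  (b <= reach n q i x)%N = ((i * b < x) && (x + (n - i) * b <= n * q))%N.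
Proof.
move=> n0 lin /andP[x1 xN]; rewrite /reach.
have [m nE] : exists m : nat, n = (i + m)%N by exists (n - i)%N; rewrite subnKC.
rewrite nE addKn in xN *; have [xi|xi] := leqP x (i * q).
  have i0 : (0 < i)%N by case: i xi {lin nE xN} => //; lia.
  rewrite leq_divRL // mulnC; apply/idP/andP => [h|[]]; last by lia.
  by split; [lia|nia].
have m0 : (0 < m)%N by case: m nE xN => //; lia.
rewrite leq_divRL // mulnC; apply/idP/andP => [h|[_ h]]; last by lia.
split; [nia|lia].
Qed.

(** The admissible differences form an integer interval [-u, v]. Reversing a progression negates b
    and exchanges i with n - i, which gives u; the extra 1 is b = 0. *)
Lemma seg_count {R : realType} (n q i x : nat) : (0 < n)%N -> (i <= n)%N ->
  (1 <= x <= n * q)%N ->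
  \sum_(ab <- aps n.+1 (seg (n * q))) (apt i ab == Posz x)%:R =
  (reach n q i x + reach n q (n - i) x + 1)%:R :> R.
Proof.
move=> n0 lin hx; set s := enum_fset (aps n.+1 (seg (n * q))).
set u := reach n q (n - i) x; set v := reach n q i x.
transitivity ((count (fun ab => apt i ab == Posz x) s)%:R : R).
  rewrite -sum1_count natr_sum [RHS]big_mkcond.
  by apply: eq_bigr => ab _; case: eqP.
congr (_%:R); rewrite -size_filter.
pose f (m : nat) : int * int := (x%:Z - (m%:Z - u%:Z) * i%:Z, m%:Z - u%:Z).
have -> : (v + u + 1)%N = size [seq f m | m <- iota 0 (v + u + 1)].
  by rewrite size_map size_iota.
apply: perm_size; apply: uniq_perm; first by rewrite filter_uniq ?fset_uniq.
  rewrite map_inj_uniq ?iota_uniq // => m m' [_]; lia.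
have n1 : (1 < n.+1)%N by [].
have finN := seg_finite (n * q).
have uP (b : nat) := reachP n q (n - i) x b n0 (leq_subr i n) hx.
have vP (b : nat) := reachP n q i x b n0 lin hx.
rewrite -/u subKn // in uP; rewrite -/v in vP.
have [m nE] : exists m : nat, n = (i + m)%N by exists (n - i)%N; rewrite subnKC.
have mE : (n - i = m)%N by rewrite nE addKn.
rewrite mE in uP vP.
have key (b : int) : (1 <= x%:Z - b * i%:Z <= (n * q)%:Z) &&
    (1 <= x%:Z + b * m%:Z <= (n * q)%:Z) = (- u%:Z <= b <= v%:Z).
  have [b0|b0] := leP 0 b.
    have -> : b = `|b|%N by lia.
    set c := `|b|%N; have := vP c; have := uP 0%N; move: hx.
    have -> : (- u%:Z <= c%:Z <= v%:Z) = (c <= v)%N by lia.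
    by move=> hx _ ->; nia.
  have -> : b = - (`|b|%N%:Z) by lia.
  set c := `|b|%N; have := uP c; move: hx.
  have -> : (- u%:Z <= - c%:Z <= v%:Z) = (c <= u)%N by lia.
  by move=> hx ->; nia.
move=> [a b]; rewrite mem_filter apt_int /=; apply/andP/mapP.
  move=> -[/eqP e /(mem_aps _ _ n1 finN)].
  move=> /(seg_kAPP _ _ _ n0) /= [h1 h2].
  have : - u%:Z <= b <= v%:Z by rewrite -key -mE; nia.
  by move=> /andP[b1 b2]; exists (absz (b + u%:Z)%R); [rewrite mem_iota; lia|congr (_, _); lia].
move=> [l]; rewrite mem_iota => hl [-> ->].
have := key (l%:Z - u%:Z); have -> : (- u%:Z <= l%:Z - u%:Z <= v%:Z) = true by lia.
move=> /andP[h1 h2]; split; first by apply/eqP; ring.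
apply: (in_aps _ _ n1 finN); apply/(seg_kAPP _ _ _ n0) => /=; split=> //.
have -> : x%:Z - (l%:Z - u%:Z) * i%:Z + (l%:Z - u%:Z) * n%:Z = x%:Z + (l%:Z - u%:Z) * m%:Z.
  by rewrite nE PoszD; ring.
by [].
Qed.

Lemma seg_deg {R : realType} (n q x : nat) : (0 < n)%N -> (1 <= x <= n * q)%N ->
  deg n.+1 (seg (n * q)) (Posz x) =
  n.+1%:R + 2 * \sum_(i < n.+1) (reach n q i x)%:R :> R.
Proof.
move=> n0 hx; rewrite /deg.
have c (i : 'I_n.+1) : \sum_(ab <- aps n.+1 (seg (n * q))) (apt i ab == Posz x)%:R =
    (reach n q i x)%:R + (reach n q (n - i) x)%:R + 1 :> R.
  by rewrite seg_count // ?natrD // -ltnS.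
rewrite (eq_bigr _ (fun i _ => c i)) !big_split /= sumr_const card_ord.
rewrite [X in _ + X + _](reindex_inj rev_ord_inj) /=.
rewrite [X in _ + X + _](eq_bigr (fun i : 'I_n.+1 => (reach n q i x)%:R)).
  by rewrite addrC; congr (_ + _); ring.
by move=> i _; rewrite subSS subKn // -ltnS.
Qed.

Lemma seg_nAP {R : realType} (n q : nat) : (0 < n)%N ->
  (nAP n.+1 (seg (n * q)))%:R =
  \sum_(1 <= x < (n * q).+1) ((reach n q 0 x)%:R + (reach n q n x)%:R + 1) :> R.
Proof.
move=> n0; have n1 : (1 < n.+1)%N by [].
rewrite nAP_sum (sum_apt n.+1 _ n1 (seg_finite (n * q)) 0 (fun=> 1)) // sum_seg.
apply: eq_big_nat => x hx.
by rewrite mulr1 (seg_count n q 0) // subn0 !natrD.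
Qed.

Lemma seg_le (N N' : nat) : (N <= N')%N -> seg N `<=` seg N'.
Proof. move=> h x; rewrite /seg /=; lia. Qed.

Lemma seg_aps_le (k N N' : nat) : (1 < k)%N -> (N <= N')%N ->
  {subset aps k (seg N) <= aps k (seg N')}.
Proof.
move=> k1 h ab /(mem_aps k _ k1 (seg_finite N)) hab.
apply: (in_aps k _ k1 (seg_finite N')) => i ik.
exact: (seg_le N N' h) (hab i ik).
Qed.

Lemma seg_nAP_le {R : realType} (k N N' : nat) : (1 < k)%N -> (N <= N')%N ->
  (nAP k (seg N))%:R <= (nAP k (seg N'))%:R :> R.
Proof.
move=> k1 h; rewrite !nAP_sum; apply: ler_sum_subset; rewrite ?fset_uniq //.
exact: seg_aps_le.
Qed.

Lemma seg_deg2_le {R : realType} (k N N' : nat) : (1 < k)%N -> (N <= N')%N ->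
  deg2 k (seg N) <= deg2 k (seg N') :> R.
Proof.
move=> k1 h; rewrite /deg2.
apply: (@le_trans _ _ (\sum_(x <- pts (seg N)) deg k (seg N') x ^+ 2)).
  apply: ler_sum => x _; apply: lerXn2r; rewrite ?nnegrE ?deg_ge0 //.
  apply: ler_sum => i _; apply: ler_sum_subset; rewrite ?fset_uniq //.
  exact: seg_aps_le.
apply: ler_sum_subset; [exact: fset_uniq| |by move=> x _; exact: sqr_ge0].
move=> x /(mem_pts _ (seg_finite N)) xN; apply: (in_pts _ (seg_finite N')).
exact: (seg_le N N' h).
Qed.

(* The real-valued version of [reach], up to an error of at most 1. *)
Definition rreach {R : realType} (n q i x : nat) : R :=
  if (x <= i * q)%N then x%:R / i%:R else (n * q - x)%:R / (n - i)%:R.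

Lemma reach_rreach {R : realType} (n q i x : nat) : (i <= n)%N -> (1 <= x <= n * q)%N ->
  @rreach R n q i x - 1 <= (reach n q i x)%:R <= @rreach R n q i x.
Proof.
(* The lower bound involves [m.+1] because [reach] divides [x.-1]. *)
have div_bound (m d : nat) : (0 < d)%N ->
    (m.+1%:R / d%:R - 1 <= (m %/ d)%:R :> R) /\ ((m %/ d)%:R <= m%:R / d%:R :> R).
  move=> d0; have d0' : 0 < d%:R :> R by rewrite ltr0n.
  split; last by rewrite ler_pdivlMr // -natrM ler_nat leq_trunc_div.
  rewrite lerBlDr ler_pdivrMr // -[1]/(1%:R) -natrD -natrM ler_nat.
  by rewrite addn1 ltn_ceil.
move=> lin /andP[x1 xN]; rewrite /rreach /reach; case: leqP => hx.
  have i0 : (0 < i)%N by case: i hx {lin} => //; lia.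
  have [h1 h2] := div_bound x.-1 i i0; rewrite prednK // in h1; rewrite h1 /=.
  by apply: (le_trans h2); rewrite ler_wpM2r ?invr_ge0 // ler_nat leq_pred.
have i0 : (0 < n - i)%N by rewrite subn_gt0 ltn_neqAle lin andbT; apply/eqP => E; subst; lia.
have [h1 ->] := div_bound (n * q - x)%N (n - i)%N i0; rewrite andbT.
apply: le_trans h1; rewrite lerD2r ler_wpM2r ?invr_ge0 // ler_nat leqnSn //.
Qed.

Lemma rreach_bound {R : realType} (n q i x : nat) : (i <= n)%N -> (1 <= x <= n * q)%N ->
  0 <= @rreach R n q i x <= q%:R.
Proof.
move=> lin /andP[x1 xN]; rewrite /rreach; case: leqP => hx.
  have i0 : (0 < i)%N by case: i hx {lin} => //; lia.
  rewrite divr_ge0 //= ler_pdivrMr ?ltr0n // -natrM ler_nat mulnC //.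
have i0 : (0 < n - i)%N by rewrite subn_gt0 ltn_neqAle lin andbT; apply/eqP => E; subst; lia.
rewrite divr_ge0 //= ler_pdivrMr ?ltr0n // -natrM ler_nat mulnBr; lia.
Qed.

(** * Riemann sums of piecewise quadratic functions *)

Lemma cvg_invn {R : realType} : q%:R^-1 @[q --> \oo] --> (0 : R).
Proof.
apply/gtr0_cvgV0; last exact: cvgr_idn.
by exists 1%N => // -[|q] // _ /=; rewrite ltr0n.
Qed.

Lemma cvg_sum_fin {R : realType} {I : Type} (r : seq I) (f : I -> nat -> R) (l : I -> R) :
  (forall i, f i q @[q --> \oo] --> l i) ->
  (\sum_(i <- r) f i q) @[q --> \oo] --> \sum_(i <- r) l i.
Proof.
move=> h; elim: r => [|i r IH].
  by under eq_cvg do rewrite big_nil; rewrite big_nil; exact: cvg_cst.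
by under eq_cvg do rewrite big_cons; rewrite big_cons; exact: cvgD.
Qed.

Lemma sum_quadratic {R : realType} (a b c : R) (m : nat) :
  \sum_(1 <= x < m.+1) (a * x%:R ^+ 2 + b * x%:R + c) =
  a * (m%:R ^+ 3 / 3 + m%:R ^+ 2 / 2 + m%:R / 6) + b * (m%:R ^+ 2 / 2 + m%:R / 2) + c * m%:R.
Proof.
elim: m => [|m IH]; first by rewrite big_geq //; ring.
by rewrite big_nat_recr //= IH -[m.+1]addn1 natrD; field.
Qed.

Definition prim3 {R : realType} (a b c t : R) : R :=
  a * t ^+ 3 / 3 + b * t ^+ 2 / 2 + c * t.

(** The summand is homogeneous of degree 2 in (x, q), so with x = q t this is a Riemann sum for a
    t^2 + b t + c on [0, m], whose integral is [prim3]. *)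
Lemma cvg_sum_quadratic {R : realType} (a b c : R) (m : nat) :
  (\sum_(1 <= x < (m * q).+1) (a * x%:R ^+ 2 + b * q%:R * x%:R + c * q%:R ^+ 2)) / q%:R ^+ 3
    @[q --> \oo] --> prim3 a b c m%:R.
Proof.
pose t (q : nat) : R := q%:R^-1.
have tl : t q @[q --> \oo] --> (0 : R) by exact: cvg_invn.
have : prim3 a b c m%:R + t q * (a * m%:R ^+ 2 / 2 + b * m%:R / 2) + t q * t q * (a * m%:R / 6)
    @[q --> \oo] --> prim3 a b c m%:R.
  rewrite -[X in _ --> X]addr0 -[X in _ --> X + _]addr0; apply: cvgD.
    apply: cvgD; first exact: cvg_cst.
    rewrite -[X in _ --> X](mul0r (a * m%:R ^+ 2 / 2 + b * m%:R / 2)); apply: cvgM => //; exact: cvg_cst.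
  rewrite -[X in _ --> X](mul0r (a * m%:R / 6)); apply: cvgM; last exact: cvg_cst.
  by rewrite -[X in _ --> X](mul0r 0); apply: cvgM.
apply: cvg_trans; apply: near_eq_cvg; exists 1%N => // q q0 /=.
have qn : q%:R != 0 :> R by rewrite pnatr_eq0 -lt0n.
rewrite sum_quadratic natrM /t /prim3; field; exact: qn.
Qed.

Lemma cvg_sum_quadratic_itv {R : realType} (a b c : R) (m m' : nat) : (m <= m')%N ->
  (\sum_((m * q).+1 <= x < (m' * q).+1) (a * x%:R ^+ 2 + b * q%:R * x%:R + c * q%:R ^+ 2))
    / q%:R ^+ 3 @[q --> \oo] --> prim3 a b c m'%:R - prim3 a b c m%:R.
Proof.
move=> mm.
rewrite [X in X @ _](_ : _ = (fun q =>
  (\sum_(1 <= x < (m' * q).+1) (a * x%:R ^+ 2 + b * q%:R * x%:R + c * q%:R ^+ 2)) / q%:R ^+ 3 -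
  (\sum_(1 <= x < (m * q).+1) (a * x%:R ^+ 2 + b * q%:R * x%:R + c * q%:R ^+ 2)) / q%:R ^+ 3)).
  by apply: cvgB; exact: cvg_sum_quadratic.
apply/funext => q; rewrite -mulrBl; congr (_ / _).
by rewrite (@big_cat_nat _ _ _ (m * q).+1 1 (m' * q).+1) //= ?ltnS ?leq_mul2r ?mm ?orbT // addrAC subrr add0r.
Qed.

(* The integral over t in [0, n] of
   min(t / i, (n - t) / (n - i)) * min(t / j, (n - t) / (n - j)), for i <= j. *)
Definition cross {R : realType} (n i j : nat) : R :=
  let c1 := (i%:R * j%:R)^-1 in
  let c2 := ((n - i)%:R * j%:R)^-1 in
  let c3 := ((n - i)%:R * (n - j)%:R)^-1 in
  prim3 c1 0 0 i%:R - prim3 c1 0 0 0%:R +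
  (prim3 (- c2) (n%:R * c2) 0 j%:R - prim3 (- c2) (n%:R * c2) 0 i%:R) +
  (prim3 c3 (- (2 * n%:R * c3)) (n%:R ^+ 2 * c3) n%:R -
   prim3 c3 (- (2 * n%:R * c3)) (n%:R ^+ 2 * c3) j%:R).

(** Cut at i q and j q: between these points each factor is a single linear piece. *)
Lemma cvg_rreach_mul {R : realType} (n i j : nat) : (i <= j)%N -> (j <= n)%N ->
  (\sum_(1 <= x < (n * q).+1) @rreach R n q i x * @rreach R n q j x) / q%:R ^+ 3
    @[q --> \oo] --> @cross R n i j.
Proof.
move=> ij jn; have lin := leq_trans ij jn.
set c1 : R := (i%:R * j%:R)^-1.
set c2 : R := ((n - i)%:R * j%:R)^-1.
set c3 : R := ((n - i)%:R * (n - j)%:R)^-1.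
have h1 := cvg_sum_quadratic_itv c1 0 0 0 i (leq0n i).
have h2 := cvg_sum_quadratic_itv (- c2) (n%:R * c2) 0 i j ij.
have h3 := cvg_sum_quadratic_itv c3 (- (2 * n%:R * c3)) (n%:R ^+ 2 * c3) j n jn.
pose P (a b c : R) (m m' q : nat) : R := (\sum_((m * q).+1 <= x < (m' * q).+1)
  (a * x%:R ^+ 2 + b * q%:R * x%:R + c * q%:R ^+ 2)) / q%:R ^+ 3.
rewrite [X in X @ _](_ : _ = (fun q => P c1 0 0 0%N i q + P (- c2) (n%:R * c2) 0 i j q +
  P c3 (- (2 * n%:R * c3)) (n%:R ^+ 2 * c3) j n q)).
  by rewrite /cross -/c1 -/c2 -/c3; apply: cvgD => //; exact: cvgD.
apply/funext => q; rewrite /P -!mulrDl; congr (_ / _).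
have le1 : (i * q <= j * q)%N by rewrite leq_mul2r ij orbT.
have le2 : (j * q <= n * q)%N by rewrite leq_mul2r jn orbT.
rewrite mul0n (@big_cat_nat _ _ _ (j * q).+1 1 (n * q).+1) //=.
rewrite (@big_cat_nat _ _ _ (i * q).+1 1 (j * q).+1) //=.
congr (_ + _ + _); apply: eq_big_nat => x /andP[x1 x2]; rewrite /rreach.
- have -> : (x <= i * q)%N by [].
  have -> : (x <= j * q)%N by apply: leq_trans le1.
  by rewrite /c1 invfM; ring.
- have -> : (x <= i * q)%N = false by apply/negbTE; rewrite -ltnNge.
  have -> : (x <= j * q)%N by [].
  rewrite natrB ?natrM; last by apply: leq_trans le2.
  by rewrite /c2 invfM; ring.
- have -> : (x <= i * q)%N = false by apply/negbTE; rewrite -ltnNge; apply: leq_ltn_trans x1.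
  have -> : (x <= j * q)%N = false by apply/negbTE; rewrite -ltnNge.
  by rewrite natrB ?natrM // /c3 invfM; ring.
Qed.

Lemma cross_diag {R : realType} (n i : nat) : (0 < n)%N -> (i <= n)%N ->
  cross n i i = n%:R / 3 :> R.
Proof.
move=> n0 lin; rewrite /cross /prim3 natrB //.
set a : R := i%:R; set b : R := n%:R.
(* At i = 0 or i = n an inverse takes the default value 0, but the corresponding interval is empty
   and the identities persist. *)
have e1 : (a * a)^-1 * a ^+ 3 = a.
  by have [->|h] := eqVneq a 0; [rewrite expr0n mulr0|field].
have e2 : ((b - a) * (b - a))^-1 * (b - a) ^+ 3 = b - a.
  by have [->|h] := eqVneq (b - a) 0; [rewrite expr0n mulr0|field].
transitivity ((a * a)^-1 * a ^+ 3 / 3 + ((b - a) * (b - a))^-1 * (b - a) ^+ 3 / 3).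
  by set c := (a * a)^-1; set c' := ((b - a) * (b - a))^-1; set d := ((b - a) * a)^-1; field.
by rewrite e1 e2; ring.
Qed.

Lemma cross_lt {R : realType} (n i j : nat) : (i < j)%N -> (j <= n)%N ->
  cross n i j = n%:R / 6 * ((n%:R ^+ 2 - i%:R ^+ 2 - (n%:R - j%:R) ^+ 2) /
    ((n%:R - i%:R) * j%:R)) :> R.
Proof.
move=> ij jn; have lin := leq_trans (ltnW ij) jn; rewrite /cross /prim3 !natrB //.
have j0 : j%:R != 0 :> R by rewrite pnatr_eq0 -lt0n; apply: leq_ltn_trans ij.
have ni0 : n%:R - i%:R != 0 :> R by rewrite -natrB // pnatr_eq0 -lt0n subn_gt0; apply: leq_trans jn.
move: j0 ni0; set a : R := i%:R; set c : R := j%:R; set b : R := n%:R => c0 ba0.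
have e1 : (a * c)^-1 * a ^+ 3 = a ^+ 2 / c.
  by have [->|h] := eqVneq a 0; [rewrite !expr0n mulr0 mul0r|field; rewrite c0 h].
have e2 : ((b - a) * (b - c))^-1 * (b - c) ^+ 3 = (b - c) ^+ 2 / (b - a).
  by have [->|h] := eqVneq (b - c) 0; [rewrite !expr0n mulr0 mul0r|field; rewrite h ba0].
transitivity ((a * c)^-1 * a ^+ 3 / 3 +
    ((b - a) * c)^-1 * (b * (c ^+ 2 - a ^+ 2) / 2 - (c ^+ 3 - a ^+ 3) / 3) +
    ((b - a) * (b - c))^-1 * (b - c) ^+ 3 / 3).
  by set d := (a * c)^-1; set d' := ((b - a) * (b - c))^-1; set d'' := ((b - a) * c)^-1; field.
by rewrite e1 e2; field; rewrite c0 ba0.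
Qed.

(** * Limits along multiples of n, and the constant gamma_k *)

Lemma cvg_of_invn_bound {R : realType} (f g : nat -> R) (l C : R) :
  (forall q, (0 < q)%N -> `|f q - g q| <= C * q%:R^-1) ->
  g q @[q --> \oo] --> l -> f q @[q --> \oo] --> l.
Proof.
move=> h gl.
have C0 : C * q%:R^-1 @[q --> \oo] --> (0 : R).
  by rewrite -[X in _ --> X](mulr0 C); apply: cvgM; [exact: cvg_cst|exact: cvg_invn].
apply: (@squeeze_cvgr _ _ _ _ (fun q => g q - C * q%:R^-1) (fun q => g q + C * q%:R^-1)).
- by exists 1%N => // q q0; move: (h q q0); rewrite ler_norml; lra.
- by rewrite -[X in _ --> X]subr0; apply: cvgB.
- by rewrite -[X in _ --> X]addr0; apply: cvgD.
Qed.

Lemma sum_sym {R : realType} (n : nat) (F : nat -> nat -> R) :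
  \sum_(i < n) \sum_(j < n) F (minn i j) (maxn i j) =
  \sum_(i < n) F i i + 2 * \sum_(j < n) \sum_(i < n | (i < j)%N) F i j.
Proof.
have E (i : 'I_n) : \sum_(j < n) F (minn i j) (maxn i j) =
    F i i + \sum_(j < n | (j < i)%N) F j i + \sum_(j < n | (i < j)%N) F i j.
  rewrite (bigD1 i) //= minnn maxnn -addrA; congr (_ + _).
  rewrite (bigID (fun j : 'I_n => (j < i)%N)) /=; congr (_ + _).
    apply: eq_big => j; first by rewrite andb_idl // => h; apply/eqP => e; rewrite e ltnn in h.
    by move=> /andP[_ ji]; rewrite (minn_idPr (ltnW ji)) (maxn_idPl (ltnW ji)).
  apply: eq_big => j; first by rewrite -leqNgt ltn_neqAle eq_sym.
  by move=> /andP[_]; rewrite -leqNgt => ij; rewrite (minn_idPl ij) (maxn_idPr ij).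
rewrite (eq_bigr _ (fun i _ => E i)) !big_split /= -addrA; congr (_ + _).
have -> : \sum_(i < n) \sum_(j < n | (i < j)%N) F i j =
    \sum_(j < n) \sum_(i < n | (i < j)%N) F i j by rewrite (exchange_big_dep xpredT).
by rewrite mulr_natl mulr2n.
Qed.

(** The diagonal terms n / 3 and twice the off-diagonal factor n / 6 share the factor n / 3; times
    4, this is n times the 4/3 in [gammak]. *)
Lemma sum_cross {R : realType} (n : nat) : (0 < n)%N ->
  4 * \sum_(i < n.+1) \sum_(j < n.+1) cross n (minn i j) (maxn i j) =
  n%:R * gammak n.+1 :> R.
Proof.
move=> n0; rewrite (sum_sym n.+1 (cross n)).
rewrite (eq_bigr (fun=> n%:R / 3)); last by move=> i _; rewrite cross_diag // -ltnS.
rewrite sumr_const card_ord -[_ *+ n.+1]mulr_natl /gammak.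
have e : n.+1%:R - 1 = n%:R :> R by rewrite -addn1 natrD addrK.
rewrite e.
set S := (X in _ = _ * (_ * (_ + X))).
have -> : \sum_(j < n.+1) \sum_(i < n.+1 | (i < j)%N) cross n i j = n%:R / 6 * S.
  rewrite mulr_sumr; apply: eq_bigr => j _; rewrite mulr_sumr; apply: eq_bigr => i ij.
  by rewrite cross_lt // -ltnS.
by field.
Qed.

Lemma cvg_sum_rreach {R : realType} (n : nat) : (0 < n)%N ->
  (\sum_(1 <= x < (n * q).+1) (2 * \sum_(i < n.+1) @rreach R n q i x) ^+ 2) / q%:R ^+ 3
    @[q --> \oo] --> (n%:R * gammak n.+1 : R).
Proof.
move=> n0; rewrite -sum_cross //.
pose P (i j q : nat) : R :=
  (\sum_(1 <= x < (n * q).+1) @rreach R n q (minn i j) x * @rreach R n q (maxn i j) x) / q%:R ^+ 3.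
rewrite [X in X @ _](_ : _ = (fun q => 4 * \sum_(i < n.+1) \sum_(j < n.+1) P i j q)).
  apply: cvgM; first exact: cvg_cst.
  apply: cvg_sum_fin => i; apply: cvg_sum_fin => j.
  apply: cvg_rreach_mul; first by rewrite geq_min leq_max leqnn.
  by rewrite geq_max; apply/andP; split; rewrite -ltnS.
apply/funext => q; rewrite /P.
under [in RHS]eq_bigr do rewrite -mulr_suml.
rewrite -mulr_suml mulrA; congr (_ / _).
under [in RHS]eq_bigr do rewrite exchange_big /=.
rewrite exchange_big /= mulr_sumr; apply: eq_bigr => x _.
rewrite exprMn -natrX; congr (_ * _); rewrite expr2 big_distrlr /=.
apply: eq_bigr => i _; apply: eq_bigr => j _.
by case: (leqP i j) => // _; rewrite mulrC.
Qed.

(** With K = n + 1, replacing [deg] by twice the sum of [rreach] changes it by at most K, while the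
    sum of both is at most K + 4 K q. Each square thus changes by at most 5 K^2 q, and there are n q
    of them. *)
Lemma cvg_seg_deg2 {R : realType} (n : nat) : (0 < n)%N ->
  deg2 n.+1 (seg (n * q)) / q%:R ^+ 3 @[q --> \oo] --> (n%:R * gammak n.+1 : R).
Proof.
move=> n0; apply: (cvg_of_invn_bound _ _ _ (5 * n.+1%:R ^+ 2 * n%:R) _ (cvg_sum_rreach n n0)).
move=> q q0; have Q0 : 0 < q%:R :> R by rewrite ltr0n.
have Q1 : 1 <= q%:R :> R by rewrite ler1n.
rewrite /deg2 sum_seg -mulrBl normrM [X in _ * X]ger0_norm ?invr_ge0 ?exprn_ge0 ?ler0n //.
rewrite ler_pdivrMr ?exprn_gt0 //.
have -> : 5 * n.+1%:R ^+ 2 * n%:R * q%:R^-1 * q%:R ^+ 3 =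
   \sum_(1 <= x < (n * q).+1) (5 * n.+1%:R ^+ 2 * q%:R) :> R.
  by rewrite sumr_const_nat subn1 /= -[RHS]mulr_natl natrM; field; lra.
rewrite -sumrB; apply: le_trans (ler_norm_sum _ _ _) _.
rewrite big_nat [leRHS]big_nat; apply: ler_sum => x hx.
rewrite seg_deg //; set V := \sum_(i < _) (reach _ _ _ _)%:R.
set M := \sum_(i < _) rreach _ _ _ _.
have K0 : 0 < n.+1%:R :> R by rewrite ltr0n.
have VM : M - n.+1%:R <= V <= M.
  apply/andP; split.
    have -> : n.+1%:R = \sum_(i < n.+1) 1 :> R by rewrite sumr_const card_ord.
    rewrite -sumrB; apply: ler_sum => i _.
    have /andP[h _] := @reach_rreach R n q i x (ltn_ord i) hx; exact: h.
  apply: ler_sum => i _.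
  have /andP[_ h] := @reach_rreach R n q i x (ltn_ord i) hx; exact: h.
have M0 : 0 <= M <= n.+1%:R * q%:R.
  apply/andP; split.
    by apply: sumr_ge0 => i _; have /andP[h _] := @rreach_bound R n q i x (ltn_ord i) hx.
  have -> : n.+1%:R * q%:R = \sum_(i < n.+1) q%:R :> R by rewrite sumr_const card_ord mulr_natl.
  by apply: ler_sum => i _; have /andP[_ h] := @rreach_bound R n q i x (ltn_ord i) hx.
have -> : (n.+1%:R + 2 * V) ^+ 2 - (2 * M) ^+ 2 =
  (n.+1%:R + 2 * (V - M)) * (n.+1%:R + 2 * (V + M)) by ring.
rewrite normrM.
apply: (@le_trans _ _ (n.+1%:R * (n.+1%:R + 4 * (n.+1%:R * q%:R)))).
  by apply: ler_pM => //; rewrite ler_norml; lra.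
have : n.+1%:R ^+ 2 * 1 <= n.+1%:R ^+ 2 * q%:R :> R by rewrite ler_wpM2l ?sqr_ge0.
nra.
Qed.

(** Counting by first term, (n q - x) / n + x / n = q gives q + O(1) differences for each of the n q
    starting points. *)
Lemma cvg_seg_nAP {R : realType} (n : nat) : (0 < n)%N ->
  (nAP n.+1 (seg (n * q)))%:R / q%:R ^+ 2 @[q --> \oo] --> (n%:R : R).
Proof.
move=> n0.
have h : (fun=> n%:R) q @[q --> \oo] --> (n%:R : R) by exact: cvg_cst.
apply: (cvg_of_invn_bound _ _ _ n%:R _ h) => q q0.
have Q0 : 0 < q%:R :> R by rewrite ltr0n.
have Qn : q%:R != 0 :> R by rewrite lt0r_neq0.
have -> : n%:R = (n%:R * q%:R * q%:R) / q%:R ^+ 2 :> R by field.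
rewrite -mulrBl normrM [X in _ * X]ger0_norm ?invr_ge0 ?exprn_ge0 ?ler0n //.
rewrite ler_pdivrMr ?exprn_gt0 //.
have -> : n%:R * q%:R * q%:R / q%:R ^+ 2 * q%:R^-1 * q%:R ^+ 2 =
  \sum_(1 <= x < (n * q).+1) 1 :> R.
  by rewrite sumr_const_nat subn1 /= natrM; field.
have -> : n%:R * q%:R * q%:R = \sum_(1 <= x < (n * q).+1) q%:R :> R.
  by rewrite sumr_const_nat subn1 /= -[RHS]mulr_natl natrM.
rewrite seg_nAP // -sumrB; apply: le_trans (ler_norm_sum _ _ _) _.
rewrite big_nat [leRHS]big_nat; apply: ler_sum => x hx.
have /andP[a1 a2] := @reach_rreach R n q 0 x (leq0n _) hx.
have /andP[b1 b2] := @reach_rreach R n q n x (leqnn _) hx.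
have [x1 xn] := andP hx.
have e : @rreach R n q 0 x + @rreach R n q n x = q%:R.
  rewrite ltnS in xn; have x0 : (x <= 0)%N = false by rewrite leqNgt x1.
  rewrite /rreach mul0n x0 xn subn0 natrB // natrM.
  have nn : n%:R != 0 :> R by rewrite pnatr_eq0 -lt0n.
  by field.
rewrite ler_norml; lra.
Qed.

(** With n = k - 1, every summand is nonnegative: i <= j <= n gives [i^2 + (n - j)^2 <= j^2 + (n -
    j)^2 <= n^2]. *)
Lemma gammak_gt0 {R : realType} (k : nat) : (0 < k)%N -> 0 < gammak k :> R.
Proof.
case: k => // n _; rewrite /gammak mulr_gt0 // ltr_wpDr ?ltr0n //.
apply: sumr_ge0 => j _; apply: sumr_ge0 => i ij.
have -> : n.+1%:R - 1 = n%:R :> R by rewrite -addn1 natrD addrK.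
have jn : j%:R <= n%:R :> R by rewrite ler_nat -ltnS.
have ij' : i%:R <= j%:R :> R by rewrite ler_nat ltnW.
have i0 : 0 <= i%:R :> R by rewrite ler0n.
rewrite divr_ge0 ?mulr_ge0 ?subr_ge0 //; last exact: le_trans jn.
nra.
Qed.

(** * From multiples of n to all N, and the conclusion *)

Lemma cvg_divn {R : realType} (n : nat) (u : nat -> R) (l : R) : (0 < n)%N ->
  u q @[q --> \oo] --> l -> u (N %/ n)%N @[N --> \oo] --> l.
Proof.
move=> n0; apply: cvg_comp => P [M _ hM].
by exists (M * n)%N => // N /= h; apply: hM => /=; rewrite leq_divRL.
Qed.

(** With q = N / n rounded down, N lies between n q and n (q + 1), and monotonicity traps the ratio
    between [Lo] and [Up]; the power of r = (q + 1) / q corrects the mismatched normalisations. *)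
Lemma cvg_seg_ratio {R : realType} (n : nat) : (0 < n)%N ->
  deg2 n.+1 (seg N) * N%:R / (nAP n.+1 (seg N))%:R ^+ 2
    @[N --> \oo] --> (gammak n.+1 : R).
Proof.
move=> n0; have n1 : (1 < n.+1)%N by [].
have nR : 0 < n%:R :> R by rewrite ltr0n.
pose s q : R := deg2 n.+1 (seg (n * q)) / q%:R ^+ 3.
pose t q : R := (nAP n.+1 (seg (n * q)))%:R / q%:R ^+ 2.
pose r (q : nat) : R := 1 + q%:R^-1.
have sl : s q @[q --> \oo] --> (n%:R * gammak n.+1 : R) by exact: cvg_seg_deg2.
have tl : t q @[q --> \oo] --> (n%:R : R) by exact: cvg_seg_nAP.
have rl : r q @[q --> \oo] --> (1 : R).
  by rewrite -[X in _ --> X]addr0; apply: cvgD; [exact: cvg_cst|exact: cvg_invn].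
have shift (u : nat -> R) (l : R) : u q @[q --> \oo] --> l -> u q.+1 @[q --> \oo] --> l.
  apply: cvg_comp => P [M _ hM]; exists M => // q /= h; apply: hM => /=; exact: leqW.
pose Lo q : R := s q * n%:R / (t q.+1 ^+ 2 * r q ^+ 4).
pose Up q : R := s q.+1 * n%:R * r q ^+ 4 / t q ^+ 2.
have Lol : Lo q @[q --> \oo] --> (gammak n.+1 : R).
  have -> : gammak n.+1 = n%:R * gammak n.+1 * n%:R / (n%:R ^+ 2 * 1 ^+ 4) :> R.
    by field; lra.
  apply: cvgM; first by apply: cvgM => //; exact: cvg_cst.
  apply: cvgV; first by rewrite expr1n mulr1 expf_neq0 // lt0r_neq0.
  by apply: cvgM; apply: cvg_pow => //; exact: shift.
have Upl : Up q @[q --> \oo] --> (gammak n.+1 : R).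
  have -> : gammak n.+1 = n%:R * gammak n.+1 * n%:R * 1 ^+ 4 / n%:R ^+ 2 :> R.
    by field; lra.
  apply: cvgM; last by apply: cvgV; [rewrite expf_neq0 // lt0r_neq0|exact: cvg_pow].
  apply: cvgM; last exact: cvg_pow.
  by apply: cvgM; [exact: shift|exact: cvg_cst].
have tpos : \forall q \near \oo, 0 < t q by apply: (cvgr_gt n%:R) => //.
have [M _ hM] := tpos.
apply: (@squeeze_cvgr _ _ _ _ (fun N => Lo (N %/ n)%N) (fun N => Up (N %/ n)%N)); last 2 first.
- exact: cvg_divn.
- exact: cvg_divn.
exists (maxn M 1 * n)%N => // N /= hN.
have : (maxn M 1 <= N %/ n)%N by rewrite leq_divRL.
set q := (N %/ n)%N; rewrite geq_max => /andP[Mq q0].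
have le1 : (n * q <= N)%N by rewrite mulnC leq_trunc_div.
have le2 : (N <= n * q.+1)%N by rewrite mulnC ltnW // ltn_ceil.
have Q0 : 0 < q%:R :> R by rewrite ltr0n.
have Q1 : 0 < q.+1%:R :> R by rewrite ltr0n.
have T0 : 0 < (nAP n.+1 (seg (n * q)))%:R :> R.
  by have := hM q Mq; rewrite /t /= pmulr_lgt0 // invr_gt0 exprn_gt0.
have TN := @seg_nAP_le R n.+1 _ _ n1 le1.
have TN' := @seg_nAP_le R n.+1 _ _ n1 le2.
have DN := @seg_deg2_le R n.+1 _ _ n1 le1.
have DN' := @seg_deg2_le R n.+1 _ _ n1 le2.
have T1 := lt_le_trans T0 TN; have T2 := lt_le_trans T1 TN'.
have rq : r q = q.+1%:R / q%:R by rewrite /r -addn1 natrD; field; lra.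
have N1 : (n * q)%:R <= N%:R :> R by rewrite ler_nat.
have N2 : N%:R <= (n * q.+1)%:R :> R by rewrite ler_nat.
apply/andP; split.
  have -> : Lo q = deg2 n.+1 (seg (n * q)) * (n * q)%:R / (nAP n.+1 (seg (n * q.+1)))%:R ^+ 2.
    by rewrite /Lo /s /t rq natrM; field; rewrite !lt0r_neq0.
  apply: ler_pM; rewrite ?mulr_ge0 ?invr_ge0 ?exprn_ge0 ?deg2_ge0 ?ler0n //.
    by apply: ler_pM; rewrite ?deg2_ge0 ?ler0n.
  rewrite lef_pV2 ?posrE ?exprn_gt0 //; apply: lerXn2r; rewrite ?nnegrE ?ler0n //.
have -> : Up q = deg2 n.+1 (seg (n * q.+1)) * (n * q.+1)%:R / (nAP n.+1 (seg (n * q)))%:R ^+ 2.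
  by rewrite /Up /s /t rq natrM; field; rewrite !lt0r_neq0.
apply: ler_pM; rewrite ?mulr_ge0 ?invr_ge0 ?exprn_ge0 ?deg2_ge0 ?ler0n //.
  by apply: ler_pM; rewrite ?deg2_ge0 ?ler0n.
rewrite lef_pV2 ?posrE ?exprn_gt0 //; apply: lerXn2r; rewrite ?nnegrE ?ler0n //.
Qed.

Lemma seg_nAP_lower {R : realType} (n : nat) : (0 < n)%N ->
  \forall N \near \oo, (8 * n%:R)^-1 * N%:R ^+ 2 <= (nAP n.+1 (seg N))%:R :> R.
Proof.
move=> n0; have n1 : (1 < n.+1)%N by [].
have nR : 0 < n%:R :> R by rewrite ltr0n.
have [M _ hM] : \forall q \near \oo,
    n%:R / 2 <= (nAP n.+1 (seg (n * q)))%:R / q%:R ^+ 2 :> R.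
  by apply: (cvgr_ge n%:R); [exact: cvg_seg_nAP|lra].
exists (maxn M 1 * n)%N => // N /= hN.
have : (maxn M 1 <= N %/ n)%N by rewrite leq_divRL.
set q := (N %/ n)%N; rewrite geq_max => /andP[Mq q0].
have le1 : (n * q <= N)%N by rewrite mulnC leq_trunc_div.
have le2 : (N <= n * q.+1)%N by rewrite mulnC ltnW // ltn_ceil.
have Q0 : 0 < q%:R :> R by rewrite ltr0n.
apply: le_trans (@seg_nAP_le R n.+1 _ _ n1 le1).
have := hM q Mq; rewrite /= ler_pdivlMr ?exprn_gt0 //; apply: le_trans.
(* Since [N <= 2 n q], [N^2 / (8 n) <= n q^2 / 2], which is half the asymptotic count; hence the
   constant 8. *)
have h : N%:R <= 2 * n%:R * q%:R :> R by rewrite -!natrM ler_nat; nia.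
apply: (@le_trans _ _ ((8 * n%:R)^-1 * (2 * n%:R * q%:R) ^+ 2)).
  rewrite ler_wpM2l ?invr_ge0 ?mulr_ge0 ?ler0n //.
  by apply: lerXn2r; rewrite ?nnegrE ?mulr_ge0 ?ler0n.
by rewrite le_eqVlt; apply/orP; left; apply/eqP; field; lra.
Qed.

Lemma seg_asymp {R : realType} (k : nat) (p delta : nat -> R) : (3 <= k)%N ->
  (forall N : nat, (0 < N)%N -> 0 < p N < 1) ->
  (forall N : nat, (0 < N)%N -> 0 < delta N) ->
  p N @[N --> \oo] --> (0 : R) ->
  delta N ^- 3 * p N ^+ (k - 2)%N * ln (1 / p N) ^+ 2 @[N --> \oo] --> +oo ->
  asymp (fun N => phi k (seg N) (p N) (delta N)) (1 / (2 * gammak k))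
    (fun N => delta N ^+ 2 * N%:R * p N).
Proof.
case: k => // n k3 hp hd p_0 hlim; have n0 : (0 < n)%N by case: n k3 {hlim}.
apply: (@phi_asymp R n.+1 (fun=> int : zmodType) seg _ (8 * n%:R)^-1) => //.
- exact: gammak_gt0.
- by rewrite invr_gt0 mulr_gt0 // ltr0n.
- have [M _ hM] := @seg_nAP_lower R n n0; exists M => // N /= MN; split.
  + exact: seg_finite.
  + exact: int_pair_bounded.
  + exact: seg_pts.
  + exact: hM.
- exact: cvg_seg_ratio.
Qed.

Theorem theorem2p6 (R : realType) (k : nat) (hk : (3 <= k)%N)
    (p delta : nat -> R)
    (hp : forall N : nat, (0 < N)%N -> 0 < p N < 1)
    (hdelta : forall N : nat, (0 < N)%N -> 0 < delta N)
    (hp0 : p N @[N --> \oo] --> (0 : R))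
    (hlim : delta N ^- 3 * p N ^+ (k - 2)%N * ln (1 / p N) ^+ 2
              @[N --> \oo] --> +oo) :
  asymp (fun N => phi k (cyclic N) (p N) (delta N))
        (1 / (2 * k%:R ^+ 2))
        (fun N => delta N ^+ 2 * N%:R * p N)
  /\
  asymp (fun N => phi k (seg N) (p N) (delta N))
        (1 / (2 * gammak k))
        (fun N => delta N ^+ 2 * N%:R * p N).
Proof.
split; [exact: cyclic_asymp|exact: seg_asymp].
Qed.
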